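(* Let $X\subset\mathbf{P}^n$ be a general hyperplane section of an arithmetically Buchsbaum, non arithmetically Cohen-Macaulay curve $C\subset\mathbf{P}^{n+1}$. Let $M=(a_{ij})_{i=1,\ldots,t;\ j=1,\ldots,r}$ be the lifting matrix of $X$. Then $a_{ij}=n$ for some $i,j$.
   Context: $k$ is an algebraically closed field (of arbitrary characteristic). A curve in $\mathbf{P}^{n+1}$ is a non-degenerate, equidimensional, locally Cohen-Macaulay closed subscheme of dimension $1$. Its deficiency module is $\mathcal{M}_C=\bigoplus_{m\in\mathbf{Z}}H^1(\mathbf{P}^{n+1},\mathcal{I}_C(m))$, a graded module over $S=k[x_0,\ldots,x_{n+1}]$. $C$ is arithmetically Cohen-Macaulay if and only if $\mathcal{M}_C=0$; $C$ is arithmetically Buchsbaum if $\mathcal{M}_C$ is annihilated by $\mathfrak{m}=(x_0,\ldots,x_{n+1})$. A general hyperplane section of $C$ is $X=C\cap H\subset H\cong\mathbf{P}^n$ for a general hyperplane $H$. For a zero-dimensional scheme $X\subset\mathbf{P}^n$, let $R=k[x_0,\ldots,x_n]$ and let $0\to\bigoplus_{i=1}^{t}R(-m_i)\to\mathbf{F}_{n-1}\to\cdots\to\mathbf{F}_2\to\bigoplus_{j=1}^{r}R(-d_j)\to I_X\to 0$ be the minimal graded free resolution of its saturated ideal (of length $n$), with $m_1\ge\cdots\ge m_t$ and $d_1\ge\cdots\ge d_r$. The lifting matrix of $X$ is the matrix of integers $(a_{ij})=(m_i-d_j)$. *)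

(* Defs.v *)
From mathcomp Require Import all_boot all_order all_algebra.
From mathcomp Require Export mpoly.

Set Implicit Arguments.
Unset Strict Implicit.
Unset Printing Implicit Defensive.

Import Order.TTheory GRing.Theory Num.Theory.
Local Open Scope ring_scope.

(* A closed subscheme of P^(N-1) over k is represented by its saturated        *)
(* homogeneous ideal in k[x_0, ..., x_(N-1)] = {mpoly k[N]}.  Subsets of the   *)
(* polynomial ring are Prop-valued, so that no decidability is assumed.        *)

Section ProjectiveSchemes.

Variables (k : fieldType) (N : nat).
Local Notation S := {mpoly k[N]}.
Local Notation K := {fraction S}.
Local Notation "x %:F" := (@tofrac _ x).
Implicit Types I J p q : S -> Prop.

Definition is_ideal I : Prop :=
  [/\ I 0, forall f g, I f -> I g -> I (f + g) & forall h f, I f -> I (h * f)].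

Definition homogeneous_ideal I : Prop :=
  is_ideal I /\ forall f d, I f -> I (pihomog mdeg d f).

(* J : (x_0, ..., x_(N-1))^oo *)
Definition saturation J : S -> Prop := fun f =>
  exists e : nat, forall m : 'X_{1..N}, mdeg m = e -> J ('X_[m] * f).

Definition saturated I : Prop := forall f, saturation I f -> I f.

(* [f \is d.-homog] for an integer degree; only f = 0 qualifies when d < 0 *)
Definition homogz (d : int) (f : S) : Prop :=
  forall m, m \in msupp f -> (mdeg m)%:Z = d.

Definition sub_ideal I J : Prop := forall f, I f -> J f.

Definition proper_sub_ideal I J : Prop :=
  sub_ideal I J /\ exists2 f, J f & ~ I f.

Definition prime_ideal p : Prop :=
  [/\ is_ideal p, ~ p 1 & forall f g, p (f * g) -> p f \/ p g].

(* scheme-theoretic points of the closed subscheme defined by I *)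
Definition point_of I p : Prop :=
  [/\ homogeneous_ideal p, prime_ideal p, exists i, ~ p 'X_i & sub_ideal I p].

Definition chain_in (Q : (S -> Prop) -> Prop) (l : nat) : Prop :=
  exists c : nat -> S -> Prop,
    (forall i, (i <= l)%N -> Q (c i)) /\
    (forall i, (i < l)%N -> proper_sub_ideal (c i) (c i.+1)).

Definition chain_dim (Q : (S -> Prop) -> Prop) (l : nat) : Prop :=
  chain_in Q l /\ forall l', chain_in Q l' -> (l' <= l)%N.

Definition scheme_dim I (l : nat) : Prop := chain_dim (point_of I) l.

Definition generic_point I p : Prop :=
  point_of I p /\ forall q, point_of I q -> sub_ideal q p -> sub_ideal p q.

Definition equidimensional I (l : nat) : Prop :=
  scheme_dim I l /\ forall p, generic_point I p -> scheme_dim p l.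

(* The elements f / g of Frac(S) with f, g homogeneous of the same degree,     *)
(* f in J and g not in p.  For a point p of the subscheme of I, its local ring *)
(* at p is the quotient of [local_ring p], the local ring of P^(N-1), by       *)
(* [local_part p I]; the maximal ideal of [local_ring p] is [local_part p p].  *)
Definition local_part p J (u : K) : Prop :=
  exists (d : nat) (f g : S),
    [/\ f \is d.-homog, g \is d.-homog, J f, ~ p g & u = f%:F / g%:F].

Definition local_ring p : K -> Prop := local_part p (fun=> True).

(* the ideal I_p + (us_0, ..., us_(i-1)) of the local ring of P^(N-1) at p *)
Definition local_ideal p I (us : seq K) (i : nat) (v : K) : Prop :=
  exists (w : K) (a : nat -> K),
    [/\ local_part p I w, forall j, local_ring p (a j)
      & v = w + \sum_(j < i) a j * us`_j].

(* [us] lifts a regular sequence of the local ring of the subscheme at p *)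
Definition local_regular_seq p I (us : seq K) : Prop :=
  (forall i, (i < size us)%N -> local_part p p us`_i) /\
  (forall i v, (i < size us)%N -> local_ring p v ->
     local_ideal p I us i (us`_i * v) -> local_ideal p I us i v).

Definition local_dim p I (l : nat) : Prop :=
  chain_dim (fun q => point_of I q /\ sub_ideal q p) l.

Definition cohen_macaulay_at p I : Prop :=
  exists us : seq K, local_regular_seq p I us /\ local_dim p I (size us).

Definition locally_cohen_macaulay I : Prop :=
  forall p, point_of I p -> cohen_macaulay_at p I.

Definition nondegenerate I : Prop :=
  forall f, f \is 1.-homog -> I f -> f = 0.

Definition curve I : Prop :=
  [/\ homogeneous_ideal I, saturated I, nondegenerate I,
      equidimensional I 1 & locally_cohen_macaulay I].

(* H^1(P^(N-1), I_C(m)) is computed by the Cech complex of the cover by the    *)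
(* D_+(x_i), with sections viewed inside Frac(S).  The cocycle condition for   *)
(* all triples (i, j, l), repetitions allowed, forces cochains to alternate.   *)

(* sections over D_+(g), g a monomial, of the sheaf I~(m) *)
Definition twisted_sections I (m : int) (g : 'X_{1..N}) (u : K) : Prop :=
  exists (e : nat) (f : S),
    [/\ I f, homogz (m + (mdeg g * e)%:Z) f & u = f%:F / ('X_[g] ^+ e)%:F].

Definition cech_cocycle I (m : int) (c : 'I_N -> 'I_N -> K) : Prop :=
  (forall i j, twisted_sections I m (U_(i) + U_(j))%MM (c i j)) /\
  (forall i j l, c j l - c i l + c i j = 0).

Definition cech_coboundary I (m : int) (c : 'I_N -> 'I_N -> K) : Prop :=
  exists h : 'I_N -> K,
    (forall i, twisted_sections I m U_(i)%MM (h i)) /\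
    (forall i j, c i j = h j - h i).

Definition deficiency_module_eq0 I : Prop :=
  forall (m : int) c, cech_cocycle I m c -> cech_coboundary I m c.

(* C is arithmetically Cohen-Macaulay iff its deficiency module M_C vanishes *)
Definition arithmetically_CM I : Prop := deficiency_module_eq0 I.

(* annihilation of M_C by (x_0, ..., x_(N-1)), tested on generators *)
Definition arithmetically_Buchsbaum I : Prop :=
  forall (m : int) c (l : 'I_N), cech_cocycle I m c ->
    cech_coboundary I (m + 1) (fun i j => ('X_l)%:F * c i j).

(* P holds on a nonempty open subset of the dual projective space; the row     *)
(* vector a stands for the hyperplane a_0 x_0 + ... + a_(N-1) x_(N-1) = 0.     *)
Definition for_general_hyperplane (P : 'rV[k]_N -> Prop) : Prop :=
  exists F : S, [/\ F != 0, exists d, F \is d.-homog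
    & forall a : 'rV[k]_N, a != 0 -> F.@[fun i => a 0 i] != 0 -> P a].

End ProjectiveSchemes.

(* B parametrizes the hyperplane a linearly: y |-> y *m B identifies P^n with  *)
(* { x | x *m a^T = 0 } in P^(n+1).                                            *)
Definition hyperplane_coords (k : fieldType) (n : nat) (a : 'rV[k]_n.+2)
    (B : 'M[k]_(n.+1, n.+2)) : Prop :=
  row_free B /\ B *m a^T = 0.

(* restriction of f to the hyperplane: x_i is replaced by \sum_j B j i y_j *)
Definition restrict_poly (k : fieldType) (n : nat) (B : 'M[k]_(n.+1, n.+2))
    (f : {mpoly k[n.+2]}) : {mpoly k[n.+1]} :=
  f \mPo [tuple \sum_(j < n.+1) B j i *: 'X_j | i < n.+2].

(* the saturated ideal in k[y_0, ..., y_n] of the section C cap H *)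
Definition section_ideal (k : fieldType) (n : nat) (I : {mpoly k[n.+2]} -> Prop)
    (B : 'M[k]_(n.+1, n.+2)) : {mpoly k[n.+1]} -> Prop :=
  saturation (fun g => exists2 f, I f & g = restrict_poly B f).

(* 0 -> F_n -> ... -> F_1 -> I -> 0 with F_p the direct sum of the R(-s), s    *)
(* running over [res_shifts p].  Elements of F_p are row vectors, so maps act  *)
(* by right multiplication; the index p = 0 is unused.  Minimality is          *)
(* expressed by the absence of nonzero constants in the matrices.              *)
Record res_data (k : fieldType) (N : nat) := ResData {
  res_shifts : nat -> seq int;
  res_gens : 'cV[{mpoly k[N]}]_(size (res_shifts 1));
  res_diff : forall p : nat,
    'M[{mpoly k[N]}]_(size (res_shifts p.+1), size (res_shifts p))
}.

Definition minimal_free_resolution (k : fieldType) (N n : nat)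
    (I : {mpoly k[N]} -> Prop) (E : res_data k N) : Prop :=
  [/\ (forall p, (n < p)%N -> res_shifts E p = [::]) /\ res_shifts E n <> [::],
      (forall j : 'I_(size (res_shifts E 1)),
         homogz (res_shifts E 1)`_j (res_gens E j 0)) /\
      (forall p (i : 'I_(size (res_shifts E p.+1)))
         (j : 'I_(size (res_shifts E p))), (0 < p)%N ->
         homogz ((res_shifts E p.+1)`_i - (res_shifts E p)`_j)
                (res_diff E p i j)),
      (forall f, I f <-> exists u : 'rV_(size (res_shifts E 1)),
         f = (u *m res_gens E) 0 0) /\
      (forall u : 'rV_(size (res_shifts E 1)), u *m res_gens E = 0 <->
         exists v : 'rV_(size (res_shifts E 2)), u = v *m res_diff E 1),
      (forall p (u : 'rV_(size (res_shifts E p.+1))), (0 < p)%N ->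
         (u *m res_diff E p = 0 <->
          exists v : 'rV_(size (res_shifts E p.+2)), u = v *m res_diff E p.+1))
    & forall p i j, (0 < p)%N -> (res_diff E p i j)@_0%MM = 0].

Definition lifting_matrix (k : fieldType) (N n : nat) (E : res_data k N) :
    'M[int]_(size (res_shifts E n), size (res_shifts E 1)) :=
  \matrix_(i, j) ((res_shifts E n)`_i - (res_shifts E 1)`_j).

(* Main.v *)
(* Let L be a general linear form, X the section of C by L = 0, and I_C the
   ideal of C.  H^1(I_C(m)) is the cokernel of S_m -> H^0(O_C(m)); take a
   section s of O_C(m) which is not induced by a form.  As C is Buchsbaum,
   every product of s with a linear form is induced by a form of degree
   m + 1.  The form inducing L s restricts to an element of I_X which is not in
   (y_0, ..., y_n) I_X, since that product lies in the restriction of I_C;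
   hence m + 1 is the degree of a minimal generator of I_X.  For a linear
   form z regular on R / I_X, the form inducing z s restricts to a nonzero
   socle element of R / (I_X + z R): otherwise s would be congruent modulo
   S_m to a multiple L t of a section t of O_C(m - 1), and L t is induced by
   a form. Following this socle element through the resolution modulo z, y_1,
   ..., y_n gives an element of F_n (x) k of degree m + 1 + n. *)

Require Import Defs.
From HB Require Import structures.
From mathcomp Require Import all_boot all_order all_algebra perm.
From mathcomp Require Import ring.
From Stdlib Require Import Classical ClassicalEpsilon.
Import Order.TTheory GRing.Theory Num.Theory.
Local Open Scope ring_scope.

Set Implicit Arguments.
Unset Strict Implicit.
Unset Printing Implicit Defensive.

(** * Graded pieces and saturation *)

(** Presenting [H^1(I_C(m))] as a cokernel amounts to [H^1(O(m)) = 0]. Instead of computing that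
    group, the Buchsbaum condition is used a first time: [x_0 c] and [x_1 c] are coboundaries, and
    dividing by [x_0] and [x_1] splits the cocycle [c]. The products [y_i f], with [f] in [I_X], lie
    in the restriction of [I_C] because [f], seen on [P^(n+1)], is locally [L t] modulo [I_C] for a
    section [t] of [O_C], and the product of [t] with a linear form is induced by a form. Generality
    of the hyperplane enters as regularity of [L] modulo [I_C]. The bad [L] lie in a finite union of
    hyperplanes, obtained by Noetherian induction without primary decomposition. The forms inducing
    [L s] and [z s] both have degree [m + 1], so [m] cancels in the difference of the two shifts. In
    the passage through the resolution the sequence [z, y_1, ...] is divided out one element at a
    time; each connecting map raises the homological and the internal degree by one, and [n] such
    steps give the constant [n]. *)

Section GradedPieces.

Variables (k : fieldType) (N : nat).
Local Notation S := {mpoly k[N]}.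
Implicit Types (d e : int) (f g h : S) (I : S -> Prop).

(** Degrees are integers because twists and differences of shifts may be negative. The value 0 in
    negative degrees lets [hcompM] hold without sign conditions. *)
Definition hcomp d f : S := if d is Posz p then pihomog mdeg p f else 0.

Lemma mcoeff_hcomp d f m :
  (hcomp d f)@_m = if (mdeg m)%:Z == d then f@_m else 0.
Proof.
case: d => [p|p] /=; last by rewrite mcoeff0.
rewrite pihomogE raddf_sum /= (_ : ((mdeg m)%:Z == p%:Z) = (mdeg m == p)) //.
rewrite big_mkcond /=; have [Sm|Sm] := boolP (m \in msupp f); last first.
  rewrite (memN_msupp_eq0 Sm) if_same big_seq_cond big1 // => m' /andP[Sm' _].
  case: ifP => // _; rewrite mcoeffZ mcoeffX; case: eqP => [mm'|];
    last by rewrite mulr0.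
  by rewrite -mm' Sm' in Sm.
rewrite (bigD1_seq m) ?msupp_uniq //= big1 ?addr0 => [|m' m'm].
  by case: ifP; rewrite ?mcoeff0 // mcoeffZ mcoeffX eqxx mulr1.
by case: ifP; rewrite ?mcoeff0 // mcoeffZ mcoeffX (negPf m'm) mulr0.
Qed.

Lemma homogzP d f : homogz d f <-> forall m, (mdeg m)%:Z != d -> f@_m = 0.
Proof.
split=> [H m|H m]; last first.
  by rewrite mcoeff_msupp => fm; apply/eqP; apply: contraNT fm => /H ->.
by move=> dm; apply: memN_msupp_eq0; apply: contra dm => /H ->.
Qed.

Lemma hcompP d f : homogz d (hcomp d f).
Proof. by apply/homogzP => m /negPf dm; rewrite mcoeff_hcomp dm. Qed.

Lemma hcomp_id d f : homogz d f -> hcomp d f = f.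
Proof.
move/homogzP => H; apply/mpolyP => m; rewrite mcoeff_hcomp.
by case: ifPn => // /H.
Qed.

Lemma hcomp_is_additive d : {morph hcomp d : f g / f - g}.
Proof.
move=> f g; apply/mpolyP => m; rewrite mcoeffB !mcoeff_hcomp mcoeffB.
by case: ifP; rewrite ?subrr.
Qed.

HB.instance Definition _ d :=
  GRing.isZmodMorphism.Build S S (hcomp d) (hcomp_is_additive d).

Lemma hcompM d e h f : homogz d h -> hcomp (d + e) (h * f) = h * hcomp e f.
Proof.
move/homogzP => H; apply/mpolyP => m; rewrite mcoeff_hcomp !mcoeffM.
have dE (m1 m2 : 'X_{1..N}) :
    m = (m1 + m2)%MM -> (mdeg m)%:Z = (mdeg m1)%:Z + (mdeg m2)%:Z :> int.
  by move=> ->; rewrite mdegD.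
have [dm|dm] := ifPn.
  apply: eq_bigr => -[m1 m2] /= /eqP /dE dm12; rewrite mcoeff_hcomp.
  case: ifPn => // dm2; have [dm1|dm1] := eqVneq (mdeg m1)%:Z d.
    by move: dm dm2; rewrite dm12 dm1 (inj_eq (addrI _)) => ->.
  by rewrite H ?mul0r.
rewrite big1 // => -[m1 m2] /= /eqP /dE dm12; rewrite mcoeff_hcomp.
case: ifPn => dm2; last by rewrite mulr0.
rewrite H ?mul0r //; apply: contra dm => /eqP dm1.
by rewrite dm12 dm1 (eqP dm2).
Qed.

Lemma homogz0 d : homogz d (0 : S).
Proof. by move=> m; rewrite msupp0. Qed.

Lemma homogzD d f g : homogz d f -> homogz d g -> homogz d (f + g).
Proof.
move=> /homogzP Hf /homogzP Hg; apply/homogzP => m dm.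
by rewrite mcoeffD Hf ?Hg ?addr0.
Qed.

Lemma homogzN d f : homogz d f -> homogz d (- f).
Proof.
by move=> /homogzP Hf; apply/homogzP => m dm; rewrite mcoeffN Hf ?oppr0.
Qed.

Lemma homogzB d f g : homogz d f -> homogz d g -> homogz d (f - g).
Proof. by move=> Hf Hg; apply/homogzD/homogzN. Qed.

Lemma homogz_sum d (T : Type) (r : seq T) (P : pred T) (F : T -> S) :
  (forall i, P i -> homogz d (F i)) -> homogz d (\sum_(i <- r | P i) F i).
Proof. by move=> H; apply: big_ind => //;
  [exact: homogz0 | exact: homogzD]. Qed.

Lemma homogzM d e f g : homogz d f -> homogz e g -> homogz (d + e) (f * g).
Proof.
by move=> Hf Hg; rewrite -(hcomp_id Hg) -(hcompM e g Hf); exact: hcompP.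
Qed.

Lemma homogzX m : homogz (mdeg m)%:Z ('X_[m] : S).
Proof. by move=> m'; rewrite msuppX inE => /eqP ->. Qed.

Lemma homogzC (c : k) : homogz 0 (c%:MP : S).
Proof.
apply/homogzP => m dm; rewrite mcoeffC; case: eqP => [m0|]; rewrite ?mulr0 //.
by rewrite m0 mdeg0 in dm.
Qed.

Lemma homogzZ d (c : k) f : homogz d f -> homogz d (c *: f).
Proof.
by move=> Hf; rewrite -mul_mpolyC -[d]add0r; apply: homogzM => //;
  exact: homogzC.
Qed.

Lemma hcomp_ideal I d f : homogeneous_ideal I -> I f -> I (hcomp d f).
Proof. by move=> [[I0 _ _] HI] If; case: d => p /=; [exact: HI | ]. Qed.

End GradedPieces.

Section Ideals.

Variables (k : fieldType) (N : nat).
Local Notation S := {mpoly k[N]}.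
Implicit Types (f g h : S) (I : S -> Prop).

Lemma idealD I f g : is_ideal I -> I f -> I g -> I (f + g).
Proof. by case=> _ + _; apply. Qed.

Lemma idealMl I h f : is_ideal I -> I f -> I (h * f).
Proof. by case=> _ _; apply. Qed.

Lemma idealMr I h f : is_ideal I -> I f -> I (f * h).
Proof. by rewrite mulrC; exact: idealMl. Qed.

Lemma idealN I f : is_ideal I -> I f -> I (- f).
Proof. by rewrite -mulN1r; exact: idealMl. Qed.

Lemma idealB I f g : is_ideal I -> I f -> I g -> I (f - g).
Proof. by move=> HI If Ig; apply: idealD => //; exact: idealN. Qed.

Lemma ideal_sum I (T : Type) (r : seq T) (P : pred T) (F : T -> S) :
  is_ideal I -> (forall i, P i -> I (F i)) -> I (\sum_(i <- r | P i) F i).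
Proof. by case=> I0 ID _ H; apply: big_ind. Qed.

Lemma idealT : is_ideal (fun _ : S => True).
Proof. by split. Qed.

Lemma ideal_ge I f (e e' : nat) i :
  is_ideal I -> (e <= e')%N -> I ('X_i ^+ e * f) -> I ('X_i ^+ e' * f).
Proof.
by move=> HI le If; rewrite -(subnK le) exprD -mulrA; exact: idealMl.
Qed.

Lemma ideal_expand I h f :
  is_ideal I -> (forall m, m \in msupp h -> I ('X_[m] * f)) -> I (h * f).
Proof.
move=> HI H; rewrite [h in h * _]mpolyE mulr_suml big_seq_cond.
apply: ideal_sum => // m /andP[Sm _].
by rewrite -mul_mpolyC -mulrA; apply: idealMl => //; exact: H.
Qed.

Lemma ideal_homog I e f h : is_ideal I ->
  (forall m : 'X_{1..N}, mdeg m = e -> I ('X_[m] * f)) ->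
  homogz e%:Z h -> I (h * f).
Proof. by move=> HI H dh; apply: ideal_expand => // m /dh [/H]. Qed.

(* A monomial of degree at least [N * e] is divisible by some x_i^e. *)
Lemma ideal_power_homog I f (e p : nat) h :
  is_ideal I -> (forall i, I ('X_i ^+ e * f)) -> (N * e < p)%N ->
  homogz p%:Z h -> I (h * f).
Proof.
move=> HI H le Hh; apply: ideal_expand => // m /Hh [dm].
have [i lei] : exists i, (e <= m i)%N.
  apply/existsP; apply: contraLR le; rewrite negb_exists => /forallP Hm.
  rewrite -leqNgt -dm mdegE -[X in (X * _)%N]card_ord -sum_nat_const.
  by apply: leq_sum => i _; rewrite ltnW // ltnNge.
have -> : 'X_[m] = 'X_[m - U_(i) *+ e] * 'X_i ^+ e :> S.
  rewrite mpolyXn -mpolyXD submK //; apply/mnm_lepP => j.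
  rewrite mulmnE mnm1E; case: eqP => [<-|//]; by rewrite mul1n.
by rewrite -mulrA; apply: idealMl.
Qed.

(** The finitely many exponents have a maximum, and a monomial of large degree contains a high power
    of some variable. In this form saturation is a condition on each chart [D_+(x_i)]. *)
Lemma saturationP I f : is_ideal I ->
  saturation I f <-> forall i, exists e, I ('X_i ^+ e * f).
Proof.
move=> HI; split=> [[e He] i|H].
  exists e; rewrite mpolyXn; apply: He; by rewrite mdegMn mdeg1 mul1n.
pose e i := proj1_sig (constructive_indefinite_description _ (H i)).
pose E := (\max_i e i)%N.
have HE i : I ('X_i ^+ E * f).
  apply: (ideal_ge HI (leq_bigmax i)).
  by rewrite /e; case: constructive_indefinite_description.
exists (N * E).+1 => m dm; apply: (ideal_power_homog HI HE (ltnSn _)).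
by rewrite -dm; exact: homogzX.
Qed.

Lemma ideal_saturation I : is_ideal I -> is_ideal (saturation I).
Proof.
move=> HI; split.
- by exists 0%N => m _; rewrite mulr0; case: HI.
- move=> f g /(saturationP _ HI) Hf /(saturationP _ HI) Hg.
  apply/(saturationP _ HI) => i; have [e He] := Hf i; have [e' He'] := Hg i.
  exists (e + e')%N; rewrite mulrDr; apply: idealD => //.
    by apply: ideal_ge He => //; exact: leq_addr.
  by apply: ideal_ge He' => //; exact: leq_addl.
- move=> h f [e He]; exists e => m /He; rewrite mulrCA; exact: idealMl.
Qed.

Lemma sub_saturation I f : is_ideal I -> I f -> saturation I f.
Proof. by move=> HI If; exists 0%N => m _; apply: idealMl. Qed.

Lemma saturated_saturation I : is_ideal I -> saturated (saturation I).
Proof.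
move=> HI f /(saturationP _ (ideal_saturation HI)) H.
apply/(saturationP _ HI) => i; have [e] := H i.
move=> /(saturationP _ HI) /(_ i) [e' He']; exists (e' + e)%N.
by rewrite exprD -mulrA.
Qed.

End Ideals.

(** * General linear forms *)

Section Noetherian.

Variables (k : fieldType) (N : nat).
Local Notation S := {mpoly k[N]}.
Implicit Types (f g h : S) (I J : S -> Prop).

(** Every tail contains an index whose value is minimal from there on; jumping from one such index
    to the next gives [p]. *)
Lemma nondecreasing_subsequence (a : nat -> nat) :
  exists p : nat -> nat, (forall i, p i < p i.+1)%N /\
    forall i j, (i <= j)%N -> (a (p i) <= a (p j))%N.
Proof.
have tail_min n : exists p, (n <= p)%N /\ forall q, (p <= q)%N -> (a p <= a q)%N.
  have [b] := ubnP (a n); elim: b n => // b IHb n /ltnSE le_anb.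
  have [[q [le_nq lt_q]]|H] := classic (exists q, (n <= q)%N /\ (a q < a n)%N).
    have [p [le_qp Hp]] := IHb q (leq_trans lt_q le_anb).
    by exists p; split=> //; exact: leq_trans le_qp.
  exists n; split=> // q le_nq; rewrite leqNgt; apply/negP => lt_q.
  by apply: H; exists q.
pose c n := proj1_sig (constructive_indefinite_description _ (tail_min n)).
have cP n : (n <= c n)%N /\ forall q, (c n <= q)%N -> (a (c n) <= a q)%N.
  by rewrite /c; case: constructive_indefinite_description.
pose p i := iter i (fun x => c x.+1) (c 0%N).
have p_inc i : (p i < p i.+1)%N by case: (cP (p i).+1).
exists p; split=> // i j le_ij.
have p_mono : (p i <= p j)%N.
  elim: j le_ij => [|j IHj]; first by rewrite leqn0 => /eqP ->.
  rewrite leq_eqVlt => /orP[/eqP -> //|/IHj le_pij].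
  exact: leq_trans le_pij (ltnW (p_inc j)).
have pc : exists n, p i = c n by case: (i) => [|i'];
  [exists 0%N | exists (p i').+1].
by case: pc => n pE; move: p_mono; rewrite pE; case: (cP n) => _; apply.
Qed.

(** The induction on [b] makes the first [b] exponents nondecreasing along one subsequence, with one
    further extraction per variable. *)
Lemma dickson (u : nat -> 'X_{1..N}) :
  exists i j, (i < j)%N /\ (u i <= u j)%MM.
Proof.
suff H b : exists p : nat -> nat, (forall i, p i < p i.+1)%N /\
    forall (l : 'I_N) i j, (l < b)%N -> (i <= j)%N -> (u (p i) l <= u (p j) l)%N.
  have [p [p_inc Hp]] := H N; exists (p 0%N), (p 1%N).
  by split=> //; apply/mnm_lepP => l; exact: Hp.
elim: b => [|b [p [p_inc Hp]]]; first by exists id; split.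
have [ltbN|leNb] := ltnP b N; last first.
  exists p; split=> // l i j _; apply: Hp; exact: leq_trans (ltn_ord l) leNb.
have [q [q_inc Hq]] :=
  nondecreasing_subsequence (fun i => u (p i) (Ordinal ltbN)).
have p_mono i j : (i <= j)%N -> (p i <= p j)%N.
  elim: j => [|j IHj]; first by rewrite leqn0 => /eqP ->.
  rewrite leq_eqVlt => /orP[/eqP -> //|/IHj le_pij].
  exact: leq_trans le_pij (ltnW (p_inc j)).
have q_mono i j : (i <= j)%N -> (q i <= q j)%N.
  elim: j => [|j IHj]; first by rewrite leqn0 => /eqP ->.
  rewrite leq_eqVlt => /orP[/eqP -> //|/IHj le_pij].
  exact: leq_trans le_pij (ltnW (q_inc j)).
exists (p \o q); split=> [i|l i j] /=.
  exact: leq_trans (p_inc _) (p_mono _ _ (q_inc i)).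
rewrite ltnS leq_eqVlt => /orP[/eqP lb|lb] le_ij; last exact/Hp/q_mono.
by have -> : l = Ordinal ltbN; [exact: val_inj | exact: Hq].
Qed.

(** Division: subtracting the right scalar multiple of [g] lowers the leading monomial of [f], and
    the monomial order is well-founded. *)
Lemma ideal_eq_mlead I J : is_ideal I -> is_ideal J -> sub_ideal I J ->
  (forall f, J f -> f != 0 -> exists g, [/\ I g, g != 0 & mlead g = mlead f]) ->
  sub_ideal J I.
Proof.
move=> HI HJ sIJ H f; move mf: (mlead f) => m.
elim/(well_founded_ind (@ltom_wf N)): m f mf => m IHm f mf Jf.
have [->|f0] := eqVneq f 0; first by case: HI.
have [g [Ig g0 mg]] := H f Jf f0.
pose c := mleadc f / mleadc g; pose h := f - c%:MP * g.
have Jh : J h by apply: idealB => //; apply: idealMl => //; exact: sIJ.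
suff Ih : I h by rewrite -(subrK (c%:MP * g) f); apply: idealD (idealMl _ _ _).
have [->|h0] := eqVneq h 0; first by case: HI.
apply: (IHm (mlead h)) => //; rewrite lt_neqAle; apply/andP; split.
  apply: contra h0 => /eqP mh; rewrite -mleadc_eq0 mh mcoeffB mcoeffCM -mf.
  by rewrite /c -[in g@_(mlead f)]mg divfK ?subrr // mleadc_eq0.
apply: le_trans (mleadB_le _ _) _; rewrite leUx mf lexx /= mul_mpolyC -mf -mg.
exact: mleadZ_le.
Qed.

(** A counterexample yields by choice a strictly increasing chain of ideals, and by [ideal_eq_mlead]
    every step brings a leading monomial not seen before. [dickson] finds one that divides a later
    one, which therefore was not new. *)
Lemma ideal_noetherian_ind (P : (S -> Prop) -> Prop) :
  (forall I, is_ideal I ->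
     (forall J, is_ideal J -> proper_sub_ideal I J -> P J) -> P I) ->
  forall I, is_ideal I -> P I.
Proof.
move=> step I HI; apply: NNPP => nPI.
pose T := {I : S -> Prop | is_ideal I /\ ~ P I}.
have next (t : T) : exists s : T, proper_sub_ideal (sval t) (sval s).
  case: t => J [HJ nPJ] /=; apply: NNPP => H; apply: nPJ;
    apply: step => // J' HJ' ltJ.
  by apply: NNPP => nPJ'; apply: H; exists (exist _ J' (conj HJ' nPJ')).
pose nx t := proj1_sig (constructive_indefinite_description _ (next t)).
have nxP t : proper_sub_ideal (sval t) (sval (nx t)).
  by rewrite /nx; case: constructive_indefinite_description.
pose c i := sval (iter i nx (exist _ I (conj HI nPI) : T)).
have cI i : is_ideal (c i) by rewrite /c; case: (iter i nx _) => ? [].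
have c_mono i j : (i <= j)%N -> sub_ideal (c i) (c j).
  elim: j => [|j IHj]; first by rewrite leqn0 => /eqP ->.
  rewrite leq_eqVlt => /orP[/eqP -> //|/IHj le_cij f /le_cij].
  by case: (nxP (iter j nx (exist _ I (conj HI nPI) : T))) => + _; apply.
have new i : exists f, [/\ c i.+1 f, f != 0 &
    forall g, c i g -> g != 0 -> mlead g <> mlead f].
  apply: NNPP => H.
  have [_ [f cf ncf]] := nxP (iter i nx (exist _ I (conj HI nPI) : T)).
  apply: ncf; apply: (ideal_eq_mlead (cI i) (cI i.+1)) cf.
    exact: c_mono.
  move=> g cg g0; apply: NNPP => Hg; apply: H; exists g; split=> // h ch h0 mh.
  by apply: Hg; exists h.
pose f i := proj1_sig (constructive_indefinite_description _ (new i)).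
have fP i : [/\ c i.+1 (f i), f i != 0 &
    forall g, c i g -> g != 0 -> mlead g <> mlead (f i)].
  by rewrite /f; case: constructive_indefinite_description.
have [i [j [lt_ij le_m]]] := dickson (fun i => mlead (f i)).
have [cfi fi0 _] := fP i; have [_ _ Hj] := fP j.
have X0 : 'X_[mlead (f j) - mlead (f i)] != 0 :> S.
  by rewrite -msize_poly_eq0 msizeX.
apply: (Hj ('X_[mlead (f j) - mlead (f i)] * f i)).
- by apply: idealMl => //; exact: c_mono cfi.
- by rewrite mulf_neq0.
- by rewrite mleadM_proper ?mulf_neq0 ?mleadc_eq0 // mleadXm submK.
Qed.

End Noetherian.

(** * Linear forms regular modulo a saturated ideal *)

Section GenericLinearForm.

Variables (k : fieldType) (N : nat).
Local Notation S := {mpoly k[N]}.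
Implicit Types (f g h : S) (I J : S -> Prop) (a : 'rV[k]_N).

Definition lform a : S := \sum_i a 0 i *: 'X_i.

Lemma lform0 : lform 0 = 0.
Proof. by rewrite /lform big1 // => i _; rewrite mxE scale0r. Qed.

Lemma lformD a b : lform (a + b) = lform a + lform b.
Proof. by rewrite -big_split; apply: eq_bigr => i _; rewrite mxE scalerDl. Qed.

Lemma lformZ c a : lform (c *: a) = c *: lform a.
Proof. by rewrite scaler_sumr; apply: eq_bigr => i _; rewrite mxE scalerA. Qed.

Lemma lform_delta i : lform (delta_mx 0 i) = 'X_i.
Proof.
rewrite /lform (bigD1 i) //= mxE !eqxx scale1r big1 ?addr0 // => j ji.
by rewrite mxE (negPf ji) andbF scale0r.
Qed.

Lemma homogz_lform a : homogz 1 (lform a).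
Proof.
apply: homogz_sum => i _; apply: homogzZ.
by have := @homogzX k N U_(i)%MM; rewrite mdeg1.
Qed.

Lemma mcoeff_lform a i : (lform a)@_U_(i)%MM = a 0 i.
Proof.
rewrite raddf_sum (bigD1 i) //= mcoeffZ mcoeffX eqxx mulr1 big1 ?addr0 //.
by move=> j ji; rewrite mcoeffZ mcoeffX eq_mnm1 (negPf ji) mulr0.
Qed.

Lemma lform_eq0 a : (lform a == 0) = (a == 0).
Proof.
apply/eqP/eqP => [a0|->]; last exact: lform0.
by apply/rowP => i; rewrite -mcoeff_lform a0 mcoeff0 mxE.
Qed.

Lemma meval_lform a (b : 'rV[k]_N) : (lform a).@[fun i => b 0 i] = (b *m a^T) 0 0.
Proof.
rewrite mxE raddf_sum; apply: eq_bigr => i _ /=.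
by rewrite mevalZ mevalXU mxE mulrC.
Qed.

(** [V] is only a predicate, so a matrix of largest rank with row space inside [V] is picked
    classically. Maximality makes the row space equal to [V], and a column of the cokernel that does
    not kill [e] is the functional. *)
Lemma separating_functional (V : 'rV[k]_N -> Prop) e :
  V 0 -> (forall u v, V u -> V v -> V (u + v)) ->
  (forall c u, V u -> V (c *: u)) -> ~ V e ->
  exists2 phi : 'rV[k]_N, phi != 0 & forall u, V u -> u *m phi^T = 0.
Proof.
move=> V0 VD VZ nVe.
pose good (A : 'M[k]_N) := forall u : 'rV_N, (u <= A)%MS -> V u.
pose P r := exists2 A, good A & \rank A = r.
pose Pb r := if excluded_middle_informative (P r) then true else false.
have PbP r : Pb r <-> P r by rewrite /Pb; case: excluded_middle_informative.
have exP : exists r, Pb r.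
  exists 0%N; apply/PbP; exists 0; last exact: mxrank0.
  by move=> u; rewrite submx0 => /eqP ->.
have leP r : Pb r -> (r <= N)%N by move=> /PbP [A _ <-]; exact: rank_leq_row.
case: (ex_maxnP exP leP) => r /PbP [A gA rA] maxr.
have VA u : V u -> (u <= A)%MS.
  move=> Vu; apply: contraT => nuA; have ltA : (A < A + u)%MS.
    by rewrite /ltmx addsmxSl addsmx_sub submx_refl.
  have: Pb (\rank (A + u)%MS).
    apply/PbP; exists (A + u)%MS => // v /sub_addsmxP [[w1 w2] /= ->].
    apply: VD; first by apply: gA; exact: submxMl.
    have -> : w2 *m u = w2 0 0 *: u by rewrite -mul_scalar_mx -mx11_scalar.
    exact: VZ.
  by move/maxr; rewrite leqNgt -rA; move: ltA; rewrite ltmxErank => /andP[_ ->].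
have /matrix0Pn [i [j ej]] : e *m cokermx A != 0.
  by rewrite -submxE; apply/negP => /gA.
exists (col j (cokermx A))^T => [|u /VA uA].
  apply: contra ej => /eqP /(congr1 trmx); rewrite trmxK trmx0 => c0.
  have : col j (e *m cokermx A) = 0 by rewrite colE -mulmxA -colE c0 mulmx0.
  by move/colP/(_ i); rewrite !mxE => ->.
by rewrite trmxK colE mulmxA; move: uA; rewrite submxE => /eqP ->;
  exact: mul0mx.
Qed.

Definition regular_mod I f := forall h, I (f * h) -> I h.

(* Noetherian induction over saturated ideals: if f * g in I with f, g not in *)
(* I, a form regular modulo (I : g) and modulo the saturation of I + (g) is *)
(* regular modulo I. *)
Lemma generic_regular_mod I : is_ideal I -> saturated I ->
  exists Phi : seq 'rV[k]_N, (forall phi, phi \in Phi -> phi != 0) /\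
    forall a, (forall phi, phi \in Phi -> a *m phi^T != 0) ->
      regular_mod I (lform a).
Proof.
move=> HI; move: I HI; apply: ideal_noetherian_ind => I HI IH sI.
have [I1|nI1] := classic (I 1).
  exists [::]; split=> // a _ h _; rewrite -[h]mulr1; exact: idealMl.
have [[f [g [Ifg nIf nIg]]]|pI] :=
    classic (exists f g, [/\ I (f * g), ~ I f & ~ I g]); last first.
  (* In this case [I] is prime, so a form is regular as soon as it lies outside [I]. As [I] is
     saturated and proper, the linear forms in [I] are a proper subspace, and a single functional
     vanishing on it suffices. *)
  have [i nIi] : exists i, ~ I 'X_i.
    apply: NNPP => H; apply: nI1; apply: sI; apply/(saturationP _ HI) => i.
    exists 1%N; rewrite mulr1 expr1; apply: NNPP => nIi; apply: H; by exists i.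
  have [||||phi phi0 Hphi] :=
      @separating_functional (fun a => I (lform a)) (delta_mx 0 i).
  - by rewrite lform0; case: HI.
  - by move=> u v Iu Iv; rewrite lformD; exact: idealD.
  - by move=> c u Iu; rewrite lformZ -mul_mpolyC; exact: idealMl.
  - by rewrite lform_delta.
  exists [:: phi]; split=> [psi|a Ha h Iah]; first by rewrite inE => /eqP ->.
  apply: NNPP => nIh; apply: pI; exists (lform a), h; split=> // /Hphi a0.
  by have := Ha phi; rewrite inE eqxx a0 eqxx => /(_ isT).
(* Both ideals used for the induction are strictly larger than [I]: the colon ideal [J1] contains
   [f], and the saturation of [Q] contains [g]. *)
pose J1 h := I (h * g); pose Q h := exists q u, I q /\ h = q + u * g.
have HJ1 : is_ideal J1.
  split; first by rewrite /J1 mul0r; case: HI.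
    by move=> u v; rewrite /J1 mulrDl; exact: idealD.
  by move=> u v; rewrite /J1 -mulrA; exact: idealMl.
have HQ : is_ideal Q.
  split; first by exists 0, 0; rewrite mul0r addr0; split=> //; case: HI.
    move=> _ _ [q [u [Iq ->]]] [q' [u' [Iq' ->]]]; exists (q + q'), (u + u').
    by split; [exact: idealD | ring].
  move=> h _ [q [u [Iq ->]]]; exists (h * q), (h * u).
  by split; [exact: idealMl | ring].
have [||Phi1 [Phi1_neq0 HPhi1]] := IH J1 HJ1.
- split; last by exists f.
  by move=> h Ih; exact: idealMr.
- move=> h /(saturationP _ HJ1) Hh; apply: sI; apply/(saturationP _ HI) => i.
  by have [e He] := Hh i; exists e; rewrite mulrA.
have HJ2 := ideal_saturation HQ.
have subQ h : Q h -> saturation Q h by exact: sub_saturation.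
have [||Phi2 [Phi2_neq0 HPhi2]] := IH _ HJ2.
- split; first by move=> h Ih; apply: subQ; exists h, 0; rewrite mul0r addr0.
  exists g => //; apply: subQ; exists 0, 1; rewrite mul1r add0r; split=> //.
  by case: HI.
- exact: saturated_saturation.
exists (Phi1 ++ Phi2); split=> [phi|a Ha h Iah].
  by rewrite mem_cat => /orP[/Phi1_neq0|/Phi2_neq0].
have reg1 : regular_mod J1 (lform a).
  by apply: HPhi1 => phi Hphi; apply: Ha; rewrite mem_cat Hphi.
have reg2 : regular_mod (saturation Q) (lform a).
  by apply: HPhi2 => phi Hphi; apply: Ha; rewrite mem_cat Hphi orbT.
have [e He] : saturation Q h.
  by apply/reg2/subQ; exists (lform a * h), 0; rewrite mul0r addr0.
apply: sI; exists e => m /He [q [u [Iq hE]]].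
rewrite hE; apply: idealD => //; apply: reg1; rewrite /J1.
have -> : lform a * u * g = 'X_[m] * (lform a * h) - lform a * q.
  by rewrite mulrCA hE; ring.
by apply: idealB => //; exact: idealMl.
Qed.

End GenericLinearForm.

Section ClosedField.

Variables (k : closedFieldType) (N : nat).

(** On the moment curve [(1, t, t^2, ...)] each functional becomes a nonzero polynomial in [t], and
    over an algebraically closed field some [t] avoids the roots of their product. *)
Lemma exists_avoiding_point (Phi : seq 'rV[k]_N) :
  (forall phi, phi \in Phi -> phi != 0) ->
  exists a : 'rV[k]_N, forall phi, phi \in Phi -> a *m phi^T != 0.
Proof.
move=> Phi_neq0.
pose P (phi : 'rV[k]_N) : {poly k} := \poly_(i < N) oapp (phi 0) 0 (insub i).
have PE (phi : 'rV[k]_N) (i : 'I_N) : (P phi)`_i = phi 0 i.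
  by rewrite coef_poly ltn_ord valK.
have P0 : \prod_(phi <- Phi) P phi != 0.
  rewrite prodf_seq_neq0; apply/allP => phi /Phi_neq0 phi0 /=.
  apply: contra phi0 => /eqP P0; apply/eqP/rowP => i.
  by rewrite -PE P0 coef0 mxE.
have [t] := closed_nonrootP _ P0; rewrite /root horner_prod.
rewrite prodf_seq_neq0 => /allP Ht.
exists (\row_i t ^+ i) => phi /Ht /=; apply: contra => /eqP /matrixP /(_ 0 0).
rewrite !mxE => H; rewrite horner_poly -[X in _ == X]H;
  apply/eqP/eq_bigr => i _.
by rewrite !mxE valK mulrC.
Qed.

(** The equation of the bad locus is a product of linear forms, one for each functional to be
    avoided. *)
Lemma general_regular_hyperplane (I : {mpoly k[N]} -> Prop) :
  is_ideal I -> saturated I ->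
  for_general_hyperplane (fun a => regular_mod I (lform a)).
Proof.
move=> HI sI; have [Phi [Phi_neq0 HPhi]] := generic_regular_mod HI sI.
exists (\prod_(phi <- Phi) lform phi); split.
- by rewrite prodf_seq_neq0; apply/allP => phi /Phi_neq0; rewrite lform_eq0.
- exists (size Phi); elim: (Phi) => [|phi s IHs].
    by rewrite big_nil dhomog1.
  rewrite big_cons /= -[(size s).+1]add1n; apply: dhomogM => //.
  by apply/dhomogP => m /homogz_lform [].
- move=> a _; rewrite rmorph_prod prodf_seq_neq0 => /allP Ha.
  apply: HPhi => phi /Ha /=; rewrite meval_lform; apply: contra => /eqP ->.
  by rewrite mxE.
Qed.

Lemma exists_regular_lform (I : {mpoly k[N]} -> Prop) :
  is_ideal I -> saturated I -> (0 < N)%N ->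
  exists2 a : 'rV[k]_N, a != 0 & regular_mod I (lform a).
Proof.
move=> HI sI N_gt0; have [Phi [Phi_neq0 HPhi]] := generic_regular_mod HI sI.
pose i0 := Ordinal N_gt0.
(* The additional functional, the first coordinate, forces [a != 0] even when [Phi] is empty. *)
have [|a Ha] := @exists_avoiding_point (delta_mx 0 i0 :: Phi).
  move=> phi; rewrite inE => /orP[/eqP ->|/Phi_neq0 //].
  by apply/eqP => /rowP /(_ i0); rewrite !mxE !eqxx; apply/eqP/oner_neq0.
exists a; last by apply: HPhi => phi Hphi; apply: Ha; rewrite inE Hphi orbT.
have := Ha _ (mem_head _ _); apply: contra => /eqP ->.
by rewrite mul0mx.
Qed.

End ClosedField.

(** * Tor and the socle *)

Section InitialIdeals.

Variables (k : fieldType) (N : nat).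
Local Notation S := {mpoly k[N]}.
Implicit Types (f g h : S) (theta : nat -> S) (s : nat -> 'I_N).

Definition span theta (l : nat) f : Prop :=
  exists v : nat -> S, f = \sum_(i < l) theta i * v i.

Lemma span_ideal theta l : is_ideal (span theta l).
Proof.
split.
- by exists (fun=> 0); rewrite big1 // => i _; rewrite mulr0.
- move=> _ _ [v ->] [w ->]; exists (fun i => v i + w i).
  by rewrite -big_split; apply: eq_bigr => i _; rewrite mulrDr.
- move=> h _ [v ->]; exists (fun i => h * v i).
  by rewrite mulr_sumr; apply: eq_bigr => i _; rewrite mulrCA.
Qed.

Lemma span0P theta f : span theta 0 f <-> f = 0.
Proof.
split=> [[v ->]|->]; first by rewrite big_ord0.
by case: (span_ideal theta 0).
Qed.

Lemma spanS theta l f v : span theta l (f - theta l * v) <->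
  exists2 w : nat -> S, f = \sum_(i < l.+1) theta i * w i & w l = v.
Proof.
split=> [[w fE]|[w -> <-]]; last first.
  by exists w; rewrite big_ord_recr /= addrK.
exists (fun i => if i == l then v else w i); last by rewrite eqxx.
rewrite big_ord_recr /= eqxx -[LHS](subrK (theta l * v)) fE; congr (_ + _).
by apply: eq_bigr => i _; rewrite ltn_eqF.
Qed.

Lemma span_step theta l f :
  span theta l.+1 f <-> exists v, span theta l (f - theta l * v).
Proof.
split=> [[v ->]|[v]].
  by exists (v l); apply/spanS; exists v.
by move=> /spanS [w -> _]; exists w.
Qed.

Definition weakly_regular theta (n : nat) : Prop :=
  forall l h, (l < n)%N -> span theta l (theta l * h) -> span theta l h.

(** An ideal generated by variables is monomial, so membership is read off the support, and
    regularity of the variables becomes a statement on exponents. *)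
Lemma span_varsP s l f : span (fun i => 'X_(s i)) l f <->
  forall m, m \in msupp f -> exists2 i, (i < l)%N & m (s i) != 0%N.
Proof.
have HV := span_ideal (fun i => 'X_(s i)) l.
split=> [[v ->] m|H].
  move=> /msupp_sum_le /flatten_mapP /= [i]; rewrite mem_filter => _.
  rewrite mulrC (perm_mem (msuppMX _ _)) => /mapP [m' _ ->].
  by exists i => //; rewrite mnmDE mnm1E eqxx.
rewrite -[f]mulr1; apply: ideal_expand => // m /H [i lt_il mi]; rewrite mulr1.
exists (fun j => if j == i then 'X_[m - U_(s i)] else 0).
rewrite (bigD1 (Ordinal lt_il)) //= eqxx big1 ?addr0 => [|j].
  by rewrite -mpolyXD addmC submK // lep1mP.
by rewrite -(inj_eq val_inj) /= => /negPf ->; rewrite mulr0.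
Qed.

Lemma weakly_regular_vars s n :
  (forall i j, (i < n)%N -> (j < n)%N -> s i = s j -> i = j) ->
  weakly_regular (fun i => 'X_(s i)) n.
Proof.
move=> s_inj l h lt_ln /span_varsP H; apply/span_varsP => m Sm.
have [|i lt_il] := H (U_(s l) + m)%MM.
  by rewrite mulrC (perm_mem (msuppMX _ _)); apply: map_f.
rewrite mnmDE mnm1E; case: (s l =P s i) => [/s_inj H'|_ mi]; last by exists i.
by have := lt_il; rewrite -(H' lt_ln (ltn_trans lt_il lt_ln)) ltnn.
Qed.

End InitialIdeals.

Lemma span_rmorphism (k : fieldType) (N N' : nat)
    (phi : {rmorphism {mpoly k[N]} -> {mpoly k[N']}}) theta l f :
  span theta l f -> span (phi \o theta) l (phi f).
Proof.
move=> [v ->]; exists (phi \o v); rewrite rmorph_sum.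
by apply: eq_bigr => i _; rewrite rmorphM.
Qed.

(* [phi] substitutes the form for a variable x_i0 occurring in it; it maps *)
(* the regular sequence of the variables, starting with x_i0, to [theta]. *)
Lemma linear_parameters (k : fieldType) (n : nat) (b : 'rV[k]_n.+1) : b != 0 ->
  exists theta : nat -> {mpoly k[n.+1]},
    [/\ theta 0%N = lform b, forall l, exists w, theta l = lform w,
        weakly_regular theta n.+1
      & forall u, u@_0%MM = 0 -> span theta n.+1 u].
Proof.
case/matrix0Pn => j0 [i0]; rewrite (ord1 j0) => {j0} b0.
(* [s] enumerates the variables with [x_i0] in position 0. *)
pose s (l : nat) := tperm ord0 i0 (inord l).
have s_inj i j : (i < n.+1)%N -> (j < n.+1)%N -> s i = s j -> i = j.
  by move=> lti ltj /perm_inj /(congr1 val); rewrite /= !inordK.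
have s0 l : (l < n.+1)%N -> (s l == i0) = (l == 0%N).
  move=> ltl; have -> : i0 = s 0%N.
    by rewrite /s (_ : inord 0 = ord0) ?tpermL //; apply: val_inj;
      rewrite /= inordK.
  by apply/eqP/eqP => [/s_inj ->|->].
have subst (F : 'I_n.+1 -> {mpoly k[n.+1]}) :
    exists g : {lrmorphism {mpoly k[n.+1]} -> {mpoly k[n.+1]}},
    forall i, g 'X_i = F i.
  exists (comp_mpoly [tuple F i | i < n.+1]) => i /=.
  by rewrite comp_mpolyXU -tnth_nth tnth_mktuple.
have [phi phiX] := subst (fun i => if i == i0 then lform b else 'X_i).
(* [psi] inverts [phi]: it solves [lform b] for [x_i0], whose coefficient is nonzero. *)
have [psi psiX] := subst (fun i => if i == i0 then
  (b 0 i0)^-1 *: ('X_i0 - \sum_(i | i != i0) b 0 i *: 'X_i) else 'X_i).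
have ext (g1 g2 : {lrmorphism {mpoly k[n.+1]} -> {mpoly k[n.+1]}}) :
    (forall i, g1 'X_i = g2 'X_i) -> g1 =1 g2.
  move=> H f; rewrite [f]mpolyE !linear_sum; apply: eq_bigr => m _.
  rewrite !linearZ /= mpolyXE_id !rmorph_prod; congr (_ *: _).
  by apply: eq_bigr => i _; rewrite !rmorphXn /= H.
have phiK f : phi (psi f) = f.
  apply: (ext (phi \o psi) idfun) => i /=; rewrite psiX.
  case: eqP => [->|/eqP ii0]; last by rewrite phiX (negPf ii0).
  rewrite linearZ linearB linear_sum /= phiX eqxx.
  have -> : \sum_(i | i != i0) phi (b 0 i *: 'X_i) = lform b - b 0 i0 *: 'X_i0.
    rewrite /lform [X in _ = X - _](bigD1 i0) //= addrAC subrr add0r;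
      apply: eq_bigr => j ji0.
    by rewrite linearZ /= phiX (negPf ji0).
  by rewrite opprB addrC subrK scalerA mulVf ?scale1r.
have psiK f : psi (phi f) = f.
  apply: (ext (psi \o phi) idfun) => i /=; rewrite phiX.
  case: eqP => [->|/eqP ii0]; last by rewrite psiX (negPf ii0).
  rewrite /lform linear_sum (bigD1 i0) //= linearZ /= psiX eqxx.
  rewrite scalerA divff // scale1r -[RHS](subrK (\sum_(i | i != i0) b 0 i *: 'X_i)).
  congr (_ + _); apply: eq_bigr => j ji0.
  by rewrite linearZ /= psiX (negPf ji0).
pose theta l := phi 'X_(s l).
have spanP l f : span theta l f <-> span (fun i => 'X_(s i)) l (psi f).
  split=> [H|/(span_rmorphism phi) /=]; last by rewrite phiK.
  have [v Hv] := span_rmorphism psi H; exists v; rewrite Hv.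
  by apply: eq_bigr => i _; rewrite /= /theta psiK.
exists theta; split.
- by rewrite /theta phiX s0.
- move=> l; rewrite /theta phiX; case: ifP => _; first by exists b.
  by exists (delta_mx 0 (s l)); rewrite lform_delta.
- move=> l h ltl /spanP; rewrite rmorphM /= {1}/theta psiK => H; apply/spanP.
  exact: (weakly_regular_vars s_inj) H.
- move=> u u0; rewrite -[u]mulr1; apply: ideal_expand; first exact: span_ideal.
  move=> m Sm; rewrite mulr1; apply/spanP.
  have [i mi] : exists i, m i != 0%N.
    apply: NNPP => H; move: Sm; have -> : m = 0%MM.
      apply/mnmP => i; rewrite mnm0E; apply/eqP; apply: contraT => mi.
      by case: H; exists i.
    by rewrite mcoeff_msupp u0 eqxx.
  rewrite -(submK (m := U_(i)%MM) (m' := m)) ?lep1mP // mpolyXD rmorphM.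
  apply: idealMl; first exact: span_ideal.
  apply/span_varsP => m'; have /[apply] : homogz 1 (psi 'X_i).
    rewrite psiX; case: ifP => _; last by rewrite -lform_delta;
      exact: homogz_lform.
    apply: homogzZ; apply: homogzB; first by rewrite -lform_delta;
      exact: homogz_lform.
    by apply: homogz_sum => j _; apply: homogzZ; rewrite -lform_delta;
      exact: homogz_lform.
  case=> /eqP /mdeg1P [j /eqP ->]; exists (tperm ord0 i0 j);
    first exact: ltn_ord.
  by rewrite /s inord_val tpermK mnm1E eqxx.
Qed.

(** * Transport of a socle class along a graded resolution *)

Section SocleDegree.

Variables (k : fieldType) (N : nat).
Local Notation R := {mpoly k[N]}.

Variables (dims : nat -> nat) (sh : forall p, 'I_(dims p) -> int).
Arguments sh : clear implicits.
Variable D : forall p, 'M[R]_(dims p.+1, dims p).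
Hypothesis homogD : forall p i j, homogz (sh p.+1 i - sh p j) (D p i j).
Hypothesis D_exact : forall p (u : 'rV[R]_(dims p.+1)),
  u *m D p = 0 <-> exists v, u = v *m D p.+1.

Variables (theta : nat -> R) (n : nat).
Hypothesis homog_theta : forall l, homogz 1 (theta l).
Hypothesis theta_reg : weakly_regular theta n.+1.
Hypothesis theta0_reg : forall (y : 'rV[R]_(dims 0)) u,
  theta 0 *: y = u *m D 0 -> exists w, y = w *m D 0.
Hypothesis theta_gen : forall u : R, u@_0%MM = 0 -> span theta n.+1 u.

(** This is vanishing in the quotient by [theta_0, ..., theta_(l-1)]; classes are handled by
    representatives, so no quotient module is formed. *)
Definition rspan l (q : nat) (x : 'rV[R]_q) : Prop :=
  forall j, span theta l (x 0 j).

Lemma rspan0 l q : rspan l (0 : 'rV_q).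
Proof. by move=> j; rewrite mxE; case: (span_ideal theta l). Qed.

Lemma rspanD l q (x y : 'rV_q) : rspan l x -> rspan l y -> rspan l (x + y).
Proof. by move=> Hx Hy j; rewrite mxE; apply: idealD => //;
  exact: span_ideal. Qed.

Lemma rspanZ l q (x : 'rV_q) h : rspan l x -> rspan l (h *: x).
Proof. by move=> Hx j; rewrite mxE; apply: idealMl => //;
  exact: span_ideal. Qed.

Lemma rspanN l q (x : 'rV_q) : rspan l x -> rspan l (- x).
Proof. by rewrite -scaleN1r; exact: rspanZ. Qed.

Lemma rspanB l q (x y : 'rV_q) : rspan l x -> rspan l y -> rspan l (x - y).
Proof. by move=> Hx Hy; apply: rspanD => //; exact: rspanN. Qed.

Lemma rspanM l q q' (x : 'rV_q) (A : 'M_(q, q')) : rspan l x -> rspan l (x *m A).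
Proof.
move=> Hx j; rewrite mxE; apply: ideal_sum; first exact: span_ideal.
by move=> i _; apply: idealMr => //; exact: span_ideal.
Qed.

Lemma rspan_reg l q (x : 'rV_q) : (l < n.+1)%N ->
  rspan l (theta l *: x) -> rspan l x.
Proof. by move=> lt_ln Hx j; apply: theta_reg => //; have := Hx j;
  rewrite mxE. Qed.

Lemma rspan_step l q (x : 'rV_q) :
  rspan l.+1 x <-> exists y, rspan l (x - theta l *: y).
Proof.
split=> [Hx|[y Hy] j]; last first.
  by apply/span_step; exists (y 0 j); have := Hy j; rewrite !mxE.
have /fin_all_exists [v Hv] j : exists v, span theta l (x 0 j - theta l * v).
  by apply/span_step.
by exists (\row_j v j) => j; rewrite !mxE.
Qed.

Lemma rspan0P q (x : 'rV_q) : rspan 0 x <-> x = 0.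
Proof.
split=> [Hx|->]; last exact: rspan0.
by apply/rowP => j; rewrite mxE; exact/span0P/Hx.
Qed.

Lemma DD p (v : 'rV_(dims p.+2)) : v *m D p.+1 *m D p = 0.
Proof. by apply/D_exact; exists v. Qed.

(* Vanishing of H_(p+1) of F / (theta_0, ..., theta_(l-1)) F *)
Definition acyclic_at l p := forall x : 'rV_(dims p.+1),
  rspan l (x *m D p) -> exists w, rspan l (x - w *m D p.+1).

(** Induction on [l] along the exact sequence of multiplication by [theta_l] modulo the earlier
    elements: the obstruction for a class in [H_(p+1)] lies in [H_p], which vanishes by induction
    when [p > 0]. For [p = 0] the bound forces [l = 0], and [theta0_reg] says that [theta_0] is
    injective on [H_0]. *)
Lemma acyclic_at_ge l p : (l <= n.+1)%N -> (l <= p.+1)%N -> acyclic_at l p.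
Proof.
elim: l p => [|l IHl] p le_ln le_lp x.
  by move=> /rspan0P /D_exact [w ->]; exists w; rewrite subrr; exact: rspan0.
have lift_cycle y z : rspan l (x *m D p - theta l *: y) -> rspan l (y - z *m D p) ->
    exists w, rspan l.+1 (x - w *m D p.+1).
  move=> Hxy Hyz;
    have [|w Hw] := IHl p (ltnW le_ln) (ltnW le_lp) (x - theta l *: z).
    rewrite mulmxBl -scalemxAl (_ : _ - _ = (x *m D p - theta l *: y) +
      theta l *: (y - z *m D p)); first by apply: rspanD => //; exact: rspanZ.
    by rewrite scalerBr addrA subrK.
  exists w; apply/rspan_step; exists z; by rewrite addrAC.
move=> /rspan_step [y Hy].
case: p le_lp x lift_cycle y Hy => [|p] le_lp x lift_cycle y Hy; last first.
  (* Since [theta_l y] is congruent to a boundary, regularity of [theta_l] makes [y] itself a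
     cycle. *)
  have [||w Hw] := IHl p (ltnW le_ln) _ y; rewrite ?ltnS //;
    last exact: lift_cycle Hw.
  apply: rspan_reg => //; rewrite scalemxAl.
  rewrite (_ : _ *m _ = - ((x *m D p.+1 - theta l *: y) *m D p)).
    by apply/rspanN/rspanM.
  by rewrite mulmxBl DD sub0r opprK.
move: le_lp; rewrite ltnS leqn0 => /eqP l0; subst l.
have [w yE] : exists w, y = w *m D 0.
  apply: (@theta0_reg y x); apply/esym/eqP; rewrite -subr_eq0;
    exact/eqP/rspan0P.
by apply: (lift_cycle y w) => //; rewrite yE subrr; exact: rspan0.
Qed.

Definition rhomog e p (x : 'rV[R]_(dims p)) : Prop :=
  forall i, homogz (e - sh p i) (x 0 i).

Definition rcomp e p (x : 'rV[R]_(dims p)) : 'rV[R]_(dims p) :=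
  \row_i hcomp (e - sh p i) (x 0 i).

Lemma rcompP e p (x : 'rV_(dims p)) : rhomog e (rcomp e x).
Proof. by move=> i; rewrite mxE; exact: hcompP. Qed.

Lemma rcompB e p (x y : 'rV_(dims p)) : rcomp e (x - y) = rcomp e x - rcomp e y.
Proof. by apply/rowP => i; rewrite !mxE raddfB. Qed.

Lemma rcomp_id e p (x : 'rV_(dims p)) : rhomog e x -> rcomp e x = x.
Proof. by move=> Hx; apply/rowP => i; rewrite mxE hcomp_id. Qed.

Lemma rcompM e p (x : 'rV_(dims p.+1)) : rcomp e (x *m D p) = rcomp e x *m D p.
Proof.
apply/rowP => j; rewrite !mxE raddf_sum; apply: eq_bigr => i _ /=.
rewrite mxE !(mulrC _ (D p i j)) -(hcompM _ _ (@homogD p i j)); congr hcomp;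
  ring.
Qed.

Lemma rcompZ e p (x : 'rV_(dims p)) l :
  rcomp (e + 1) (theta l *: x) = theta l *: rcomp e x.
Proof.
apply/rowP => j; rewrite !mxE -(hcompM _ _ (@homog_theta l)); congr hcomp; ring.
Qed.

Lemma rspan_rcomp e l p (x : 'rV_(dims p)) : rspan l x -> rspan l (rcomp e x).
Proof.
elim: l x => [|l IHl] x; first by move=> /rspan0P ->;
  rewrite -[0]subr0 rcompB subrr; exact: rspan0.
move=> /rspan_step [y /IHl Hy]; apply/rspan_step; exists (rcomp (e - 1) y).
by rewrite -rcompZ subrK -rcompB.
Qed.

(* [x] represents a nonzero class, killed by all theta_l, in *)
(* H_j of F / (theta_0, ..., theta_j) F *)
Definition socle_class j (x : 'rV[R]_(dims j)) : Prop :=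
  ~ (exists w, rspan j.+1 (x - w *m D j)) /\
  forall l, (l < n.+1)%N -> exists y, rspan j.+1 (theta l *: x - y *m D j).

(* The class of [y] with [d y = theta_(j+1) x] is the image of the class of x *)
(* under the isomorphism of H_j onto the socle of H_(j+1). *)
Lemma socle_class_step e j (x : 'rV_(dims j)) : (j < n)%N -> rhomog e x ->
  socle_class x -> exists2 y : 'rV_(dims j.+1), rhomog (e + 1) y & socle_class y.
Proof.
move=> lt_jn Hx [x_neq0 x_soc]; have [y0 Hy0] := x_soc j.+1 lt_jn.
(* Only the component of degree [e + 1] of the lift matters, as [theta_(j+1) x] has that degree.
   This is where one homological step costs exactly one internal degree. *)
pose y := rcomp (e + 1) y0; have Hy : rspan j.+1 (theta j.+1 *: x - y *m D j).
  rewrite /y -rcompM -(rcomp_id Hx) -rcompZ -rcompB; exact: rspan_rcomp.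
exists y; first exact: rcompP.
split=> [[w /rspan_step [v Hv]]|l lt_ln].
  apply: x_neq0; exists v; apply: rspan_reg => //.
  rewrite (_ : _ *: _ = (theta j.+1 *: x - y *m D j) +
    (y - w *m D j.+1 - theta j.+1 *: v) *m D j).
    by apply: rspanD => //; exact: rspanM.
  by rewrite !mulmxBl DD subr0 -scalemxAl scalerBr addrA subrK.
have [yl Hyl] := x_soc l lt_ln.
(* [theta_l y] and [theta_(j+1) yl] both map to [theta_l theta_(j+1) x], so their difference is a
   cycle where homology vanishes. Modulo [theta_(j+1)] this makes [theta_l y] a boundary. *)
have [|||w Hw] := @acyclic_at_ge j.+1 j _ _ (theta l *: y - theta j.+1 *: yl) => //.
- exact: ltnW.
- rewrite (_ : _ *m _ = theta j.+1 *: (theta l *: x - yl *m D j) -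
    theta l *: (theta j.+1 *: x - y *m D j)).
    by apply: rspanB; exact: rspanZ.
  rewrite mulmxBl -!scalemxAl !scalerBr !scalerA [theta l * _]mulrC.
  by rewrite opprB [RHS]addrC addrA subrK.
- exists w; apply/rspan_step; exists yl.
  by move: Hw; rewrite addrAC.
Qed.

Lemma socle_shift e (x : 'rV_(dims 0)) : rhomog e x -> socle_class x ->
  exists i, sh n i = e + n%:Z.
Proof.
move=> Hx x_soc.
have H j : (j <= n)%N ->
    exists2 y : 'rV_(dims j), rhomog (e + j%:Z) y & socle_class y.
  elim: j => [|j IHj] lt_jn; first by exists x; rewrite ?addr0.
  have [y Hy y_soc] := IHj (ltnW lt_jn).
  have [z Hz z_soc] := socle_class_step lt_jn Hy y_soc; exists z => //.
  by rewrite -addrA -PoszD addn1 in Hz.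
have [y Hy [y_neq0 _]] := H n (leqnn n).
(* If no shift equals [e + n], no entry of [y] has a constant term; by [theta_gen] then [y] vanishes
   modulo [theta_0, ..., theta_n], contradicting that its class is nonzero. *)
apply: NNPP => no_i; apply: y_neq0; exists 0; rewrite mul0mx subr0 => i.
apply: theta_gen; move/homogzP: (Hy i); apply.
rewrite mdeg0; apply/eqP => /eqP; rewrite eq_sym subr_eq0 => /eqP Hi.
by apply: no_i; exists i.
Qed.

End SocleDegree.

(** * Cech cohomology of the ideal sheaf *)

Section TwistedSections.

Variables (k : fieldType) (N : nat).
Local Notation S := {mpoly k[N]}.
Local Notation K := {fraction S}.
Local Notation "x %:F" := (@tofrac _ x).
Implicit Types (f g h : S) (I J : S -> Prop) (u v : K) (m d : int)
  (mu nu : 'X_{1..N}).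

Lemma mpolyXe_neq0 mu e : 'X_[mu] ^+ e != 0 :> S.
Proof. by rewrite expf_neq0 // -msize_poly_eq0 msizeX. Qed.

Lemma tofracXe_neq0 mu e : ('X_[mu] ^+ e : S)%:F != 0.
Proof. by rewrite tofrac_eq0 mpolyXe_neq0. Qed.

Lemma eq_tofrac_div f f' h h' : h != 0 -> h' != 0 ->
  f%:F / h%:F = f'%:F / h'%:F -> f * h' = f' * h.
Proof.
move=> h0 h'0 /eqP; rewrite eqr_div ?tofrac_eq0 //.
by rewrite -!tofracM tofrac_eq => /eqP.
Qed.

Lemma homogzXe mu e : homogz (mdeg mu * e)%:Z ('X_[mu] ^+ e : S).
Proof. by rewrite mpolyXn -mdegMn; exact: homogzX. Qed.

Lemma tw_raise J m mu e e' f : is_ideal J -> J f ->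
  homogz (m + (mdeg mu * e)%:Z) f ->
  [/\ J (f * 'X_[mu] ^+ e'),
      homogz (m + (mdeg mu * (e + e'))%:Z) (f * 'X_[mu] ^+ e')
    & f%:F / ('X_[mu] ^+ e)%:F =
      (f * 'X_[mu] ^+ e')%:F / ('X_[mu] ^+ (e + e'))%:F].
Proof.
move=> HJ Jf df; split; first exact: idealMr.
  by rewrite mulnDr PoszD addrA; apply: homogzM => //; exact: homogzXe.
by rewrite exprD !tofracM -mulf_div divff ?mulr1 // tofracXe_neq0.
Qed.

Lemma tw_sub J J' m mu u : sub_ideal J J' ->
  twisted_sections J m mu u -> twisted_sections J' m mu u.
Proof. by move=> sJJ' [e [f [/sJJ' J'f df uE]]]; exists e, f. Qed.

Lemma tw_poly J m mu f : J f -> homogz m f -> twisted_sections J m mu f%:F.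
Proof.
move=> Jf df; exists 0%N, f; rewrite muln0 addr0 expr0 tofrac1 divr1.
by split.
Qed.

Lemma twD J m mu u v : is_ideal J -> twisted_sections J m mu u ->
  twisted_sections J m mu v -> twisted_sections J m mu (u + v).
Proof.
move=> HJ [e [f [Jf df ->]]] [e' [f' [Jf' df' ->]]].
have [Jg dg ->] := tw_raise e' HJ Jf df.
have [Jg' dg' ->] := tw_raise e HJ Jf' df'.
exists (e + e')%N, (f * 'X_[mu] ^+ e' + f' * 'X_[mu] ^+ e).
rewrite [(e' + e)%N]addnC in dg' *.
by rewrite tofracD mulrDl; split=> //; [exact: idealD | exact: homogzD].
Qed.

Lemma twM J m d mu u h : is_ideal J -> homogz d h ->
  twisted_sections J m mu u -> twisted_sections J (m + d) mu (h%:F * u).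
Proof.
move=> HJ dh [e [f [Jf df ->]]]; exists e, (h * f).
rewrite tofracM mulrA addrAC addrC; split=> //; first exact: idealMl.
exact: homogzM.
Qed.

Lemma twN J m mu u : is_ideal J ->
  twisted_sections J m mu u -> twisted_sections J m mu (- u).
Proof.
move=> HJ [e [f [Jf df ->]]]; exists e, (- f).
by rewrite tofracN mulNr; split=> //; [exact: idealN | exact: homogzN].
Qed.

Lemma twB J m mu u v : is_ideal J -> twisted_sections J m mu u ->
  twisted_sections J m mu v -> twisted_sections J m mu (u - v).
Proof. by move=> HJ Hu Hv; apply: twD => //; exact: twN. Qed.

Lemma tw0 J m mu : is_ideal J -> twisted_sections J m mu 0.
Proof. by case=> J0 _ _; rewrite -tofrac0; apply: tw_poly => //;
  exact: homogz0. Qed.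

Lemma tw_sum J m mu (T : Type) (r : seq T) (P : pred T) (F : T -> K) :
  is_ideal J -> (forall i, P i -> twisted_sections J m mu (F i)) ->
  twisted_sections J m mu (\sum_(i <- r | P i) F i).
Proof.
by move=> HJ H; apply: big_ind => // [|u v]; [exact: tw0 | exact: twD].
Qed.

Lemma tw_restrict J m mu nu u : is_ideal J ->
  twisted_sections J m mu u -> twisted_sections J m (mu + nu)%MM u.
Proof.
move=> HJ [e [f [Jf df ->]]]; exists e, (f * 'X_[nu] ^+ e); split.
- exact: idealMr.
- rewrite mdegD mulnDl PoszD addrA; apply: homogzM => //; exact: homogzXe.
- by rewrite mpolyXD exprMn !tofracM -mulf_div divff ?mulr1 ?tofracXe_neq0.
Qed.

Lemma tw_restrictl J m mu nu u : is_ideal J ->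
  twisted_sections J m mu u -> twisted_sections J m (nu + mu)%MM u.
Proof. by rewrite addmC; exact: tw_restrict. Qed.

Lemma tw_regular J m d mu u h : is_ideal J -> regular_mod J h ->
  twisted_sections (fun=> True) m mu u ->
  twisted_sections J (m + d) mu (h%:F * u) -> twisted_sections J m mu u.
Proof.
move=> HJ hreg [e [f [_ df uE]]] [e' [q [Jq dq]]].
rewrite {}uE mulrA -tofracM => /(eq_tofrac_div (mpolyXe_neq0 _ _) (mpolyXe_neq0 _ _)) hE.
have [_ dg ->] := tw_raise e' (idealT _ _) (Logic.I : True) df.
exists (e + e')%N, (f * 'X_[mu] ^+ e'); split=> //.
by apply: hreg; rewrite mulrA hE; exact: idealMr.
Qed.

(** An ideal and its saturation have the same sections over [D_+(x_i)]: the missing power of [x_i]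
    is moved into the denominator. *)
Lemma tw_regular_sat J m d i u h : is_ideal J -> regular_mod (saturation J) h ->
  twisted_sections (fun=> True) m U_(i)%MM u ->
  twisted_sections J (m + d) U_(i)%MM (h%:F * u) ->
  twisted_sections J m U_(i)%MM u.
Proof.
move=> HJ hreg Hu Hhu.
have [e [f [/(saturationP _ HJ) /(_ i) [e' Jf] df ->]]] :
    twisted_sections (saturation J) m U_(i)%MM u.
  apply: tw_regular (tw_sub _ Hhu) => //; first exact: ideal_saturation.
  by move=> g; exact: sub_saturation.
have [_ dg ->] := tw_raise e' (idealT _ _) (Logic.I : True) df.
by exists (e + e')%N, (f * 'X_i ^+ e'); split=> //; rewrite mulrC.
Qed.

(** The return from charts to polynomials: a denominator [x_i^e] is exactly an exponent that
    saturation allows. *)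
Lemma tw_saturation J m f : is_ideal J -> homogz m f ->
  (forall i, twisted_sections J m U_(i)%MM f%:F) <-> saturation J f.
Proof.
move=> HJ df; split=> [H|/(saturationP _ HJ) H i].
  apply/(saturationP _ HJ) => i; have [e [q [Jq dq]]] := H i.
  rewrite -[f%:F]divr1 -tofrac1.
  move=> /(eq_tofrac_div (oner_neq0 _) (mpolyXe_neq0 _ _)).
  by rewrite mulr1 mulrC => fE; exists e; rewrite fE.
have [e Jf] := H i; exists e, ('X_i ^+ e * f); split=> //.
  by rewrite addrC; apply: homogzM => //; exact: homogzXe.
by rewrite tofracM mulrC mulKf ?tofracXe_neq0.
Qed.

Lemma span_var1 i f : (forall mu, mu \in msupp f -> mu i != 0%N) ->
  exists g, f = 'X_i * g.
Proof.
move=> H; have [v] : span (fun=> 'X_i) 1 f.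
  by apply/(@span_varsP _ _ (fun=> i)) => mu /H mui; exists 0%N.
by rewrite big_ord_recl big_ord0 addr0 => ->; exists (v 0%N).
Qed.

Lemma var_divides i j f h e : i != j -> f * 'X_j ^+ e = 'X_i * h ->
  exists g, f = 'X_i * g.
Proof.
move=> ij E; apply: span_var1 => mu fmu.
have := map_f (mnm_add (U_(j) *+ e)%MM) fmu.
rewrite -(perm_mem (msuppMX _ _)) -mpolyXn E mulrC (perm_mem (msuppMX _ _)).
move=> /mapP [nu _ /mnmP /(_ i)]; rewrite !mnmDE mulmnE !mnm1E eqxx.
by rewrite eq_sym (negPf ij) mul0n add0n => ->.
Qed.

Lemma homogz_varM m i f : homogz (m + 1) ('X_i * f) -> homogz m f.
Proof.
move=> H mu fmu; apply: (addIr 1); rewrite -[RHS](H (U_(i) + mu)%MM).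
  by rewrite mdegD mdeg1 PoszD addrC.
by rewrite mulrC (perm_mem (msuppMX _ _)); exact: map_f.
Qed.

(** Two charts suffice, as their union has a complement of codimension two. In
    [f / x_i^e = f' / x_j^e'] with [e > 0], the variable [x_i] divides [f x_j^e'], hence [f], and
    [e] drops. *)
Lemma tw_glue m i j u : i != j ->
  twisted_sections (fun=> True) m U_(i)%MM u ->
  twisted_sections (fun=> True) m U_(j)%MM u ->
  exists2 f, homogz m f & u = f%:F.
Proof.
move=> ij [e [f [_ df uE]]] [e' [f' [_ df' uE']]].
elim: e f df uE => [|e IHe] f df uE.
  exists f; first by rewrite muln0 addr0 in df.
  by rewrite uE expr0 tofrac1 divr1.
have := uE';
  rewrite {1}uE => /(eq_tofrac_div (mpolyXe_neq0 _ _) (mpolyXe_neq0 _ _)).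
rewrite exprS mulrCA => /(var_divides ij) [g fE]; apply: (IHe g).
  apply: (@homogz_varM _ i); rewrite -fE; move: df.
  by rewrite mdeg1 !mul1n -addrA -PoszD addn1.
rewrite uE fE exprS !tofracM -mulf_div divff ?mul1r // tofrac_eq0.
by have := mpolyXe_neq0 U_(i)%MM 1.
Qed.

End TwistedSections.

(** * Sections of [O_C(m)] and the Buchsbaum condition *)

Section DeficiencyModule.

Variables (k : fieldType) (N : nat).
Local Notation S := {mpoly k[N]}.
Local Notation K := {fraction S}.
Local Notation "x %:F" := (@tofrac _ x).
Implicit Types (f g h : S) (J : S -> Prop) (u v : K) (m d : int).

Variable I : S -> Prop.
Hypothesis HI : is_ideal I.

(* H^0(C, O_C(m)) as the compatible families of sections of O(m) over the *)
(* D_+(x_i); H^1(I(m)) is its quotient by the image of the forms of degree m. *)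
Definition global_section m (s : 'I_N -> K) : Prop :=
  (forall i, twisted_sections (fun=> True) m U_(i)%MM (s i)) /\
  (forall i j, twisted_sections I m (U_(i) + U_(j))%MM (s j - s i)).

Definition congruent_form m (s : 'I_N -> K) g : Prop :=
  homogz m g /\ forall i, twisted_sections I m U_(i)%MM (s i - g%:F).

Definition lifts m (s : 'I_N -> K) : Prop := exists g, congruent_form m s g.

(** With [h0] and [h1] bounding [x_i0 c] and [x_i1 c], both [h0 / x_i0] and [h1 / x_i1] have
    coboundary [c], but with unwanted poles. Correcting the numerators by forms [p] and [q] makes
    the two quotients agree, and a common value has neither pole. *)
Lemma cocycle_split (i0 i1 i2 : 'I_N) m c :
  i0 != i1 -> i0 != i2 -> i1 != i2 ->
  arithmetically_Buchsbaum I -> cech_cocycle I m c ->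
  exists2 s, forall i, twisted_sections (fun=> True) m U_(i)%MM (s i)
           & forall i j, c i j = s j - s i.
Proof.
move=> i01 i02 i12 HB Hc.
have [h0 [Hh0 c0]] := HB m c i0 Hc; have [h1 [Hh1 c1]] := HB m c i1 Hc.
have sT : sub_ideal I (fun=> True) by [].
have dX (i : 'I_N) : homogz 1 ('X_i : S).
  by rewrite -lform_delta; exact: homogz_lform.
have X0 (i : 'I_N) : ('X_i : S)%:F != 0.
  by have := tofracXe_neq0 k U_(i)%MM 1.
(* [t] measures how far [h0 / x_i0] and [h1 / x_i1] are from agreeing. It is the same on all charts,
   hence a form [g] of degree [m + 2]. *)
pose t i := ('X_i1)%:F * h0 i - ('X_i0)%:F * h1 i.
have t_const i j : t i = t j.
  apply/eqP; rewrite -subr_eq0; apply/eqP.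
  have -> : t i - t j = ('X_i0)%:F * (h1 j - h1 i) - ('X_i1)%:F * (h0 j - h0 i).
    by rewrite /t; ring.
  by rewrite -c0 -c1; ring.
have tT i : twisted_sections (fun=> True) (m + 1 + 1) U_(i)%MM (t i).
  by apply: twB; rewrite //; apply: twM => //; exact: tw_sub sT _.
have [|g dg tg] := tw_glue i01 (tT i0); first by rewrite (t_const i0 i1);
  exact: tT.
(* Clearing denominators on [D_+(x_i2)] puts a multiple of [g] by a power of [x_i2] into the ideal
   of [x_i0] and [x_i1]. As [x_i2] is regular modulo that ideal, [g] lies in it. *)
have [p [q [dp dq gE]]] : exists p q, [/\ homogz (m + 1) p, homogz (m + 1) q &
    g = 'X_i1 * p - 'X_i0 * q].
  pose s (l : nat) := if l == 0%N then i0 else i1.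
  have [v gE] : span (fun l => 'X_(s l)) 2 g.
    have [[e [f [_ _ fE]]] [e' [f' [_ _ fE']]]] := (Hh0 i2, Hh1 i2).
    apply/span_varsP => mu gmu.
    have gE : 'X_i2 ^+ (e + e') * g =
        'X_i1 * 'X_i2 ^+ e' * f - 'X_i0 * 'X_i2 ^+ e * f'.
      apply/eqP; rewrite -tofrac_eq; apply/eqP.
      rewrite tofracM -tg (t_const i0 i2) /t fE fE' exprD !(tofracM, tofracB).
      have fracE (F : fieldType) (a b x0 x1 y z : F) : a != 0 -> b != 0 ->
          a * b * (x1 * (y / a) - x0 * (z / b)) = x1 * b * y - x0 * a * z.
        by move=> a0 b0; field; rewrite a0 b0.
      by apply: fracE; exact: tofracXe_neq0.
    have: span (fun l => 'X_(s l)) 2 ('X_i2 ^+ (e + e') * g).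
      exists (fun l => if l == 0%N then - ('X_i2 ^+ e * f') else 'X_i2 ^+ e' * f).
      by rewrite gE !big_ord_recl big_ord0 /s /=; ring.
    move/span_varsP => /(_ (U_(i2) *+ (e + e') + mu)%MM) [].
      by rewrite mulrC mpolyXn (perm_mem (msuppMX _ _)); exact: map_f.
    move=> l ltl; rewrite mnmDE mulmnE mnm1E => mul; exists l => //.
    by move: mul; rewrite /s; case: ifP => _;
      rewrite (eq_sym i2) ?(negPf i02) ?(negPf i12).
  exists (hcomp (m + 1) (v 1%N)), (hcomp (m + 1) (- v 0%N)).
  split; [exact: hcompP | exact: hcompP |].
  rewrite -!(hcompM _ _ (@dX _)) -raddfB -[LHS](hcomp_id dg) [1 + _]addrC.
  by congr hcomp; rewrite gE !big_ord_recl big_ord0 /s /=; ring.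
pose s i := (h0 i - p%:F) / ('X_i0)%:F.
have sE i : s i = (h1 i - q%:F) / ('X_i1)%:F.
  have crossE (F : fieldType) (x0 x1 a b y z : F) :
      x1 * a - x0 * b = x1 * y - x0 * z -> (a - y) * x1 = (b - z) * x0.
    move=> E; apply/eqP; rewrite -subr_eq0; apply/eqP.
    have -> : (a - y) * x1 - (b - z) * x0 =
        (x1 * a - x0 * b) - (x1 * y - x0 * z) by ring.
    by rewrite E subrr.
  apply/eqP; rewrite /s eqr_div ?X0 //; apply/eqP/crossE.
  by have := tg; rewrite (t_const i0 i) /t gE tofracB !tofracM.
exists s => [i|i j]; last first.
  by rewrite /s -mulrBl opprB addrA subrK -c0 mulrC mulKf.
have sT0 i' f : homogz (m + 1) f ->
    twisted_sections (fun=> True) (m + 1) U_(i')%MM f%:F.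
  by move=> df; exact: tw_poly.
have [-> {i}|ii0] := eqVneq i i0.
  have [e [f [_ df fE]]] : twisted_sections (fun=> True) (m + 1) U_(i0)%MM (h0 i0 - p%:F).
    by apply: twB; [by [] | exact: tw_sub sT _ | exact: sT0].
  exists e.+1, f; split=> //.
    by move: df; rewrite mdeg1 !mul1n -addrA -PoszD add1n.
 
    by rewrite /s fE exprS tofracM -mulrA -invfM mulrC [_ * (_ ^+ e)%:F]mulrC mulrC.
have [e [f [_ df fE]]] : twisted_sections (fun=> True) (m + 1) U_(i)%MM (h0 i - p%:F).
  by apply: twB; [by [] | exact: tw_sub sT _ | exact: sT0].
have [e' [f' [_ df' fE']]] : twisted_sections (fun=> True) (m + 1) U_(i)%MM (h1 i - q%:F).
  by apply: twB; [by [] | exact: tw_sub sT _ | exact: sT0].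
(* Away from the chart of [x_i0] the division by [x_i0] has to be exact: comparing the two
   expressions of [s i] shows that [x_i0] divides the numerator [f]. *)
have E : 'X_i1 * 'X_i ^+ e' * f = 'X_i0 * ('X_i ^+ e * f').
  apply/eqP; rewrite -tofrac_eq !tofracM.
  have fracE (F : fieldType) (a b x0 x1 y z : F) :
      a != 0 -> b != 0 -> x0 != 0 -> x1 != 0 ->
      y / a / x0 = z / b / x1 -> x1 * b * y = x0 * (a * z).
    move=> a0 b0 x00 x10 yz; have -> : y = y / a / x0 * (x0 * a).
      by field; rewrite ?a0 ?x00.
    by rewrite yz; field; rewrite ?b0 ?x10.
  apply/eqP; apply: (fracE); rewrite ?X0 ?tofracXe_neq0 //.
  by rewrite -fE -fE' -sE.
have [g1 /esym Eg1] : exists g1, 'X_i1 * f = 'X_i0 * g1.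
  apply: (@var_divides _ _ i0 i _ ('X_i ^+ e * f') e'); first by rewrite eq_sym.
  by rewrite -E; ring.
have [g' fg'] : exists g', f = 'X_i0 * g'.
  by apply: (@var_divides _ _ i0 i1 _ g1 1); rewrite // expr1 mulrC.
exists e, g'; split=> //.
  by apply: (@homogz_varM _ _ _ i0); rewrite -fg' addrAC.
by rewrite /s fE fg' tofracM mulrAC [X in X / _ / _]mulrC mulfK.
Qed.

Lemma global_section_cocycle m s : global_section m s ->
  cech_cocycle I m (fun i j => s j - s i).
Proof. by case=> _ Hs; split=> // i j l; ring. Qed.

(** The cocycle [s_j - s_i] becomes a coboundary after multiplication by [x_l]. Subtracting the
    bounding cochain from [x_l s] leaves a family that is equal on all charts, so a form by
    [tw_glue]; linear combinations of these forms serve all [lform a]. *)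
Lemma Buchsbaum_lifts m s a (i0 i1 : 'I_N) : i0 != i1 -> arithmetically_Buchsbaum I ->
  global_section m s -> lifts (m + 1) (fun i => (lform a)%:F * s i).
Proof.
move=> i01 HB Hs; have sT : sub_ideal I (fun=> True) by [].
have /fin_all_exists [G HG] (l : 'I_N) :
    exists g, congruent_form (m + 1) (fun i => ('X_l)%:F * s i) g.
  have [h [Hh hE]] := HB m _ l (global_section_cocycle Hs).
  pose t i := ('X_l)%:F * s i - h i.
  have t_const i j : t i = t j.
    apply/eqP; rewrite -subr_eq0 /t; apply/eqP.
    have -> : ('X_l)%:F * s i - h i - (('X_l)%:F * s j - h j) =
      h j - h i - ('X_l)%:F * (s j - s i) by ring.
    by rewrite hE subrr.
  have tT i : twisted_sections (fun=> True) (m + 1) U_(i)%MM (t i).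
    apply: twB => //; last exact: tw_sub sT _.
    by apply: twM => //; [rewrite -lform_delta; exact: homogz_lform | case: Hs].
  have [|g dg tg] := tw_glue i01 (tT i0); first by rewrite (t_const i0 i1);
    exact: tT.
  exists g; split=> // i;
    rewrite -tg (t_const i0 i) /t opprB addrCA subrr addr0.
  exact: Hh.
exists (\sum_l a 0 l *: G l); split.
  by apply: homogz_sum => l _; apply: homogzZ; case: (HG l).
move=> i; rewrite /= /lform !rmorph_sum /= mulr_suml -sumrB.
apply: tw_sum => // l _; rewrite /= -!mul_mpolyC !tofracM -mulrA -mulrBr.
by rewrite -[m + 1]addr0; apply: twM => //; [exact: homogzC | case: (HG l)].
Qed.

Lemma exists_nonliftable (i0 i1 i2 : 'I_N) :
  i0 != i1 -> i0 != i2 -> i1 != i2 -> arithmetically_Buchsbaum I ->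
  ~ arithmetically_CM I -> exists m s, global_section m s /\ ~ lifts m s.
Proof.
move=> i01 i02 i12 HB nACM; apply: NNPP => H; apply: nACM => m c Hc.
have [s Hs cE] := cocycle_split i01 i02 i12 HB Hc.
have [g [dg Hg]] : lifts m s.
  apply: NNPP => ns; apply: H; exists m, s; split=> //; split=> // i j.
  by rewrite -cE; case: Hc.
by exists (fun i => s i - g%:F); split=> // i j; rewrite cE; ring.
Qed.

Hypothesis homogI : homogeneous_ideal I.
Hypothesis HB : arithmetically_Buchsbaum I.
Variables (i0 i1 : 'I_N).
Hypothesis i01 : i0 != i1.
Hypothesis satI : saturated I.
Variable a : 'rV[k]_N.
Local Notation L := (lform a).
Hypothesis Lreg : regular_mod I L.

(** The ideal [I + (L)] of [S] defines [C cap H] inside [P^(n+1)]. Staying in [S] keeps the sections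
    on [C] and on [C cap H] in one fraction field. *)
Definition section_cone f : Prop := exists q b, I q /\ f = q + L * b.
Local Notation IL := section_cone.

Lemma section_cone_ideal : is_ideal IL.
Proof.
split; first by exists 0, 0; rewrite mulr0 addr0; split=> //; case: HI.
  move=> _ _ [q [b [Iq ->]]] [q' [b' [Iq' ->]]]; exists (q + q'), (b + b').
  by split; [exact: idealD | ring].
move=> h _ [q [b [Iq ->]]]; exists (h * q), (h * b).
by split; [exact: idealMl | ring].
Qed.

Lemma section_cone_hcomp d q b :
  hcomp d (q + L * b) = hcomp d q + L * hcomp (d - 1) b.
Proof.
rewrite raddfD /= -(hcompM _ _ (@homogz_lform _ _ a)); congr (_ + hcomp _ _);
  ring.
Qed.

Lemma homogeneous_section_cone d f : IL f -> IL (hcomp d f).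
Proof.
move=> [q [b [Iq ->]]]; rewrite section_cone_hcomp.
by exists (hcomp d q), (hcomp (d - 1) b); split=> //; exact: hcomp_ideal.
Qed.

Lemma sat_section_cone_hcomp d f : saturation IL f -> saturation IL (hcomp d f).
Proof.
move=> /(saturationP _ section_cone_ideal) H.
apply/(saturationP _ section_cone_ideal) => i; have [e He] := H i; exists e.
by rewrite -(hcompM _ _ (@homogzXe _ _ _ _)); exact: homogeneous_section_cone.
Qed.

Lemma tw_section_cone m mu v : twisted_sections IL m mu v ->
  exists t q, [/\ twisted_sections (fun=> True) (m - 1) mu t,
    twisted_sections I m mu q & v = L%:F * t + q].
Proof.
move=> [e [f [[q [b [Iq fE]]] df ->]]].
exists ((hcomp (m + (mdeg mu * e)%:Z - 1) b)%:F / ('X_[mu] ^+ e)%:F).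
exists ((hcomp (m + (mdeg mu * e)%:Z) q)%:F / ('X_[mu] ^+ e)%:F); split.
- by exists e, (hcomp (m + (mdeg mu * e)%:Z - 1) b); split=> //; rewrite addrAC;
  exact: hcompP.
- exists e, (hcomp (m + (mdeg mu * e)%:Z) q).
  by split=> //; [exact: hcomp_ideal | exact: hcompP].
- rewrite mulrA -mulrDl -tofracM -tofracD; congr (_%:F / _).
  by rewrite -(hcomp_id df) fE section_cone_hcomp addrC.
Qed.

(* A family which vanishes on the hyperplane section is L times a section of *)
(* O_C(m - 1). *)
Lemma divide_by_form m (v : 'I_N -> K) :
  (forall i j, twisted_sections I m (U_(i) + U_(j))%MM (v j - v i)) ->
  (forall i, twisted_sections IL m U_(i)%MM (v i)) ->
  exists2 t, global_section (m - 1) t &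
    forall i, twisted_sections I m U_(i)%MM (v i - L%:F * t i).
Proof.
move=> Hvv Hv; have /fin_all_exists2 [t Ht Hq] (i : 'I_N) :
    exists2 t, twisted_sections (fun=> True) (m - 1) U_(i)%MM t &
      twisted_sections I m U_(i)%MM (v i - L%:F * t).
  by have [t [q [Ht Hq ->]]] := tw_section_cone (Hv i); exists t;
    rewrite // addrC addKr.
exists t => //; split=> // i j.
have Ht' l mu : twisted_sections (fun=> True) (m - 1) (U_(l) + mu)%MM (t l).
  exact: tw_restrict.
(* Compatibility on overlaps holds after multiplication by [L], and [L] can be cancelled modulo
   [I]. *)
apply: (tw_regular (d := 1) HI Lreg).
  by apply: twB => //; rewrite addmC.
rewrite subrK (_ : _ * _ = v j - v i - (v j - L%:F * t j) + (v i - L%:F * t i)).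
  apply: twD => //; last exact: tw_restrict.
  by apply: twB => //; exact: tw_restrictl.
by rewrite mulrBr; ring.
Qed.

(** By [divide_by_form], [p] is [L t] modulo [I] on the charts. If the form [g] induces [w t], then
    [w p - L g] is a section of [I] on every chart, and so lies in the saturated ideal [I]. *)
Lemma section_cone_socle m p w : homogz m p -> saturation IL p -> IL (lform w * p).
Proof.
move=> dp Sp; have IL_tw := (tw_saturation section_cone_ideal dp).2 Sp.
have [i j|t Ht Hp] := divide_by_form (v := fun=> p%:F) _ IL_tw.
  by rewrite subrr; exact: tw0.
have [g [dg Hg]] := Buchsbaum_lifts w i01 HB Ht.
rewrite subrK in dg Hg.
exists (lform w * p - L * g), g; split; last by rewrite subrK.
apply: satI; apply/(tw_saturation (m := m + 1) HI) => [|i].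
  by apply: homogzB; rewrite addrC; apply: homogzM => //; exact: homogz_lform.
rewrite tofracB !tofracM (_ : _ - _ =
    (lform w)%:F * (p%:F - L%:F * t i) + L%:F * ((lform w)%:F * t i - g%:F)).
  by apply: twD => //; apply: twM => //; exact: homogz_lform.
by ring.
Qed.

Variables (m : int) (s : 'I_N -> K).
Hypotheses (Hs : global_section m s) (s_nonlift : ~ lifts m s).

(** Were [g = q + L b] with [q] in [I], cancelling [L] in [L (s - b)] would show that the component
    of [b] of degree [m] induces [s]. *)
Lemma lform_lift_section_cone g :
  congruent_form (m + 1) (fun i => L%:F * s i) g -> saturation IL g /\ ~ IL g.
Proof.
move=> [dg Hg]; split.
  apply/(tw_saturation section_cone_ideal dg) => i.
  rewrite (_ : g%:F = L%:F * s i - (L%:F * s i - g%:F)); last by ring.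
  apply: twB; first exact: section_cone_ideal; last first.
    by apply: (tw_sub _ (Hg i)) => q Iq; exists q, 0; rewrite mulr0 addr0.
  have [e [f [_ df ->]]] := Hs.1 i.
  exists e, (L * f); split; last by rewrite tofracM mulrA.
    by exists 0, f; rewrite add0r; split=> //; case: HI.
  by rewrite addrAC addrC; apply: homogzM => //; exact: homogz_lform.
move=> [q [b [Iq gE]]]; apply: s_nonlift; exists (hcomp m b); split.
  exact: hcompP.
move=> i; apply: (tw_regular (d := 1) HI Lreg).
  by apply: twB => //; [case: Hs | apply: tw_poly => //; exact: hcompP].
rewrite mulrBr (_ : _ - _ = L%:F * s i - g%:F + (hcomp (m + 1) q)%:F).
  by apply: twD => //; apply: tw_poly; [exact: hcomp_ideal | exact: hcompP].
by rewrite -[g](hcomp_id dg) gE section_cone_hcomp addrK tofracD tofracM; ring.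
Qed.

(** With [h] inducing [w s], the forms [w g] and [z h] both induce [z w s]; as [I] is saturated,
    their difference lies in [I]. *)
Lemma lform_lift_socle z g w : congruent_form (m + 1) (fun i => (lform z)%:F * s i) g ->
  exists h, IL (lform w * g - lform z * h).
Proof.
move=> [dg Hg]; have [h [dh Hh]] := Buchsbaum_lifts w i01 HB Hs.
exists h, (lform w * g - lform z * h), 0; rewrite mulr0 addr0; split=> //.
apply: satI; apply/(tw_saturation (m := m + 1 + 1) HI) => [|i].
  by apply: homogzB; rewrite addrC; apply: homogzM => //; exact: homogz_lform.
rewrite tofracB !tofracM (_ : _ - _ = (lform z)%:F * ((lform w)%:F * s i - h%:F) -
    (lform w)%:F * ((lform z)%:F * s i - g%:F)).
  by apply: twB => //; apply: twM => //; exact: homogz_lform.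
by ring.
Qed.

(** Cancelling [z] on [C cap H] shows that [s - b'] vanishes there, so it is some [L t] modulo [I].
    If [h] induces [L t], then [b' + h] induces [s]. *)
Lemma lform_lift_notin z g : regular_mod (saturation IL) (lform z) ->
  congruent_form (m + 1) (fun i => (lform z)%:F * s i) g ->
  ~ exists p b, saturation IL p /\ g = p + lform z * b.
Proof.
move=> zreg [dg Hg] [p [b [Sp gE]]].
pose p' := hcomp (m + 1) p; pose b' := hcomp m b.
have gE' : g = p' + lform z * b'.
  rewrite -(hcomp_id dg) gE raddfD /= -(hcompM _ _ (@homogz_lform _ _ z)).
  by rewrite [1 + m]addrC.
have Hb i : twisted_sections IL m U_(i)%MM (s i - b'%:F).
  apply: (tw_regular_sat (d := 1) section_cone_ideal zreg).
    by apply: twB => //; [case: Hs | apply: tw_poly => //; exact: hcompP].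
  rewrite mulrBr (_ : _ - _ = ((lform z)%:F * s i - g%:F) + p'%:F); last first.
    by rewrite gE' tofracD tofracM; ring.
  apply: twD; first exact: section_cone_ideal.
    apply: (tw_sub _ (Hg i)) => q Iq.
    by exists q, 0; rewrite mulr0 addr0.
  apply: (tw_saturation section_cone_ideal (@hcompP _ _ _ _)).2.
  exact: sat_section_cone_hcomp.
have [i j|t Ht Hq] := divide_by_form _ Hb.
  by rewrite (_ : _ - _ = s j - s i); [case: Hs | ring].
have [h [dh Hh]] := Buchsbaum_lifts a i01 HB Ht; rewrite subrK in dh Hh.
apply: s_nonlift; exists (b' + h); split; first by apply: homogzD => //;
  exact: hcompP.
move=> i;
  rewrite (_ : _ - _ = (s i - b'%:F - L%:F * t i) + (L%:F * t i - h%:F)).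
  exact: twD.
by rewrite tofracD; ring.
Qed.

End DeficiencyModule.

(** * Restriction to a hyperplane *)

Section Substitution.

Variables (k : fieldType) (N N' : nat).
Variable g : {lrmorphism {mpoly k[N]} -> {mpoly k[N']}}.

Lemma rmorph_mpolyX mu : g 'X_[mu] = \prod_i g 'X_i ^+ mu i.
Proof.
by rewrite mpolyXE_id rmorph_prod; apply: eq_bigr => i _; rewrite rmorphXn.
Qed.

Lemma homogz_substitution d f : (forall i, homogz 1 (g 'X_i)) ->
  homogz d f -> homogz d (g f).
Proof.
move=> Hg df; rewrite [f]mpolyE linear_sum big_seq_cond.
apply: homogz_sum => mu /andP[/df <- _]; rewrite linearZ; apply: homogzZ => /=.
rewrite rmorph_mpolyX mdegE.
apply: (big_ind2 (fun (d : nat) h => homogz d%:Z h)).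
- by rewrite -mpolyC1; exact: homogzC.
- by move=> d1 h1 d2 h2 H1 H2; rewrite PoszD; exact: homogzM.
- move=> i _; elim: (mu i) => [|e IHe]; first by rewrite expr0 -mpolyC1;
  exact: homogzC.
  by rewrite exprS -add1n PoszD; apply: homogzM.
Qed.

Lemma homogz_substX (w : 'I_N -> 'rV[k]_N') i e :
  (forall i, g 'X_i = lform (w i)) -> homogz e%:Z (g ('X_i ^+ e)).
Proof.
move=> gX; apply: homogz_substitution => [j|]; first by rewrite gX;
  exact: homogz_lform.
by have := @homogzXe k N U_(i)%MM e; rewrite mdeg1 mul1n.
Qed.

End Substitution.

Lemma exists_substitution (k : fieldType) (N N' : nat) (A : 'M[k]_(N, N')) :
  exists g : {lrmorphism {mpoly k[N]} -> {mpoly k[N']}},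
    (forall f, g f = f \mPo [tuple lform (row i A) | i < N]) /\
    forall w, g (lform w) = lform (w *m A).
Proof.
exists (comp_mpoly [tuple lform (row i A) | i < N]); split=> // w.
rewrite mulmx_sum_row (big_morph (@lform k _) (@lformD _ _) (lform0 _ _)).
rewrite {1}/lform linear_sum; apply: eq_bigr => i _.
by rewrite lformZ linearZ /= comp_mpolyXU -tnth_nth tnth_mktuple.
Qed.

Section HyperplaneSection.

Variables (k : fieldType) (n : nat).
Local Notation S := {mpoly k[n.+2]}.
Local Notation R := {mpoly k[n.+1]}.
Variables (a : 'rV[k]_n.+2) (B : 'M[k]_(n.+1, n.+2)) (C : 'M[k]_(n.+2, n.+1)).
Hypotheses (a_neq0 : a != 0) (Bfree : row_free B) (Ba0 : B *m a^T = 0).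
Hypothesis BC : B *m C = 1%:M.

Variables (rho : {lrmorphism S -> R}) (sigma : {lrmorphism R -> S}).
Hypothesis rhoE : forall f, restrict_poly B f = rho f.
Hypothesis rho_lform : forall w, rho (lform w) = lform (w *m B^T).
Hypothesis sigma_lform : forall w, sigma (lform w) = lform (w *m C^T).

Lemma rho_hyperplane : rho (lform a) = 0.
Proof.
rewrite rho_lform -[a]trmxK -trmx_mul Ba0 trmx0; exact: lform0.
Qed.

Lemma sigmaK f : rho (sigma f) = f.
Proof.
rewrite [f in LHS]mpolyE !linear_sum [RHS]mpolyE; apply: eq_bigr => m _.
rewrite !linearZ; congr (_ *: _); rewrite /= mpolyXE_id !rmorph_prod.
apply: eq_bigr => i _; rewrite !rmorphXn /= -lform_delta sigma_lform rho_lform.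
by rewrite -mulmxA -trmx_mul BC trmx1 mulmx1.
Qed.

(** The kernel of the restriction is generated by [lform a]. The property passes to sums and
    products, which reduces it to constants and variables. *)
Lemma sigma_rho_mod f : exists h, f - sigma (rho f) = lform a * h.
Proof.
pose P f := exists h, f - sigma (rho f) = lform a * h.
have PD f1 f2 : P f1 -> P f2 -> P (f1 + f2).
  move=> [h1 E1] [h2 E2]; exists (h1 + h2).
  by rewrite !rmorphD /= opprD addrACA E1 E2 mulrDr.
have PM f1 f2 : P f1 -> P f2 -> P (f1 * f2).
  move=> [h1 E1] [h2 E2]; exists (h1 * f2 + sigma (rho f1) * h2).
  rewrite !rmorphM /= mulrDr mulrA -E1 mulrCA -E2; ring.
have PC c : P c%:MP.
  by exists 0; rewrite mulr0 -alg_mpolyC !rmorph_alg subrr.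
have PX i : P 'X_i.
  pose w : 'rV[k]_n.+2 := delta_mx 0 i - delta_mx 0 i *m B^T *m C^T.
  have wB : w *m B^T = 0.
    by rewrite mulmxBl -!mulmxA -[C^T *m _]trmx_mul BC trmx1 mulmx1 subrr.
  (* [B] has rank [n + 1], so the row kernel of [B^T] is a line; it contains [a], which is
     nonzero. *)
  have [c wE] : exists c, w = c *: a.
    have aK : (a <= kermx B^T)%MS.
      by apply/sub_kermxP; rewrite -[a]trmxK -trmx_mul Ba0 trmx0.
    have Ka : (kermx B^T <= a)%MS.
      rewrite -(geq_leqif (mxrank_leqif_sup aK)) mxrank_ker mxrank_tr.
      by rewrite (eqP Bfree) subSnn lt0n mxrank_eq0.
    have /submxP [c ->] : (w <= a)%MS.
      by apply: submx_trans Ka; apply/sub_kermxP.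
    by exists (c 0 0); rewrite -mul_scalar_mx -mx11_scalar.
  exists c%:MP; rewrite mulrC mul_mpolyC -lformZ -wE -lform_delta.
  rewrite rho_lform sigma_lform -[- lform _](mulN1r) -mpolyC1 -mpolyCN.
  by rewrite mul_mpolyC -lformZ -lformD scaleN1r.
rewrite [f]mpolyE; apply: (big_ind P) => // [|m _].
  by exists 0; rewrite !rmorph0 subr0 mulr0.
rewrite -mul_mpolyC mpolyXE_id; apply: (PM) => //.
apply: (big_ind P) => // [|i _]; first by rewrite -mpolyC1.
elim: (m i) => [|e IHe]; first by rewrite expr0 -mpolyC1.
by rewrite exprS; apply: PM.
Qed.

Variable I : S -> Prop.
Hypothesis HI : is_ideal I.
Local Notation IL := (section_cone I a).
Local Notation IX := (section_ideal I B).

Definition restricted_ideal (g : R) : Prop := exists2 f, I f & g = restrict_poly B f.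

Lemma restricted_idealE f : restricted_ideal (rho f) <-> IL f.
Proof.
split=> [[q Iq]|[q [b [Iq ->]]]]; last first.
  by exists q => //; rewrite rhoE rmorphD rmorphM /= rho_hyperplane mul0r addr0.
rewrite rhoE => E; have [h Eh] := sigma_rho_mod (f - q).
exists q, h; split=> //; rewrite -Eh rmorphB /= E subrr rmorph0 subr0.
by rewrite addrC subrK.
Qed.

Lemma restricted_ideal_ideal : is_ideal restricted_ideal.
Proof.
split; first by exists 0; [case: HI | rewrite rhoE rmorph0].
  move=> _ _ [f If ->] [h Ih ->]; exists (f + h); first exact: idealD.
  by rewrite !rhoE rmorphD.
move=> h _ [f If ->]; exists (sigma h * f); first exact: idealMl.
by rewrite !rhoE rmorphM /= sigmaK.
Qed.

Lemma IX_ideal : is_ideal IX.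
Proof. exact: ideal_saturation restricted_ideal_ideal. Qed.

(** Both substitutions send [x_i^e] to a form of degree [e], so an exponent valid on one side is
    valid on the other. *)
Lemma section_idealE f : IX (rho f) <-> saturation IL f.
Proof.
have HIL := section_cone_ideal HI a; have HJ := restricted_ideal_ideal.
split=> [[e He]|[e He]];
  [apply/(saturationP _ HIL) | apply/(saturationP _ HJ)] => i.
  exists e; apply/restricted_idealE; rewrite rmorphM.
  apply: (ideal_homog (I := restricted_ideal) _ He) => //;
    apply: homogz_substX => j.
  by rewrite -lform_delta; exact: rho_lform.
exists e; rewrite -['X_i ^+ e]sigmaK -rmorphM; apply/restricted_idealE.
apply: (ideal_homog (I := IL) _ He) => //; apply: homogz_substX => j.
by rewrite -lform_delta; exact: sigma_lform.
Qed.

End HyperplaneSection.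

(** * Degrees read off the minimal resolution *)

Section Resolutions.

Variables (k : fieldType) (N n : nat).
Local Notation R := {mpoly k[N]}.
Variables (J : R -> Prop) (E : res_data k N).
Hypothesis HE : minimal_free_resolution n J E.

(** Graded Nakayama: without a generator of degree [d], the coefficients expressing [f] have no
    constant term, so [f] lies in the product of the irrelevant ideal and [J]. [J'] is any ideal
    containing that product; it will be the restriction of [I_C]. *)
Lemma generator_degree (J' : R -> Prop) d f :
  is_ideal J' ->
  (forall e p i, homogz e p -> J p -> J' ('X_i * p)) ->
  homogz d f -> J f -> ~ J' f -> exists j : 'I_(size (res_shifts E 1)),
    (res_shifts E 1)`_j = d.
Proof.
move=> HJ' mJ df; case: HE => _ [dgen _] [HJ _] _ _ /HJ [u fE] nJ'f.
apply: NNPP => no_j; apply: nJ'f.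
rewrite -(hcomp_id df) fE mxE raddf_sum; apply: ideal_sum => // j _.
rewrite /= mulrC -[d](subrK (res_shifts E 1)`_j) [_ - _ + _]addrC.
rewrite (hcompM _ _ (@dgen j)) mulrC; apply: ideal_expand => // mu.
move=> /(@hcompP _ _ _ (u 0 j)) dmu; have [i mui] : exists i, mu i != 0%N.
  apply: NNPP => H; apply: no_j; exists j; apply/eqP; rewrite eq_sym -subr_eq0.
  rewrite -dmu (_ : mu = 0%MM) ?mdeg0 //; apply/mnmP => i; rewrite mnm0E.
  by apply/eqP; apply: contraT => mui; case: H; exists i.
rewrite -(submK (m := U_(i)%MM) (m' := mu)) ?lep1mP // mpolyXD -mulrA.
apply: idealMl => //; apply: (mJ _ _ _ (@dgen j)); apply/HJ.
by exists (delta_mx 0 j); rewrite -rowE mxE.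
Qed.

Definition res_rank p : nat := if p is q.+1 then size (res_shifts E q.+1) else 1.

Definition res_degree p : 'I_(res_rank p) -> int :=
  if p is q.+1 then fun i => (res_shifts E q.+1)`_i else fun=> 0.

Definition res_map p : 'M[R]_(res_rank p.+1, res_rank p) :=
  if p is q.+1 then res_diff E q.+1 else res_gens E.

Lemma res_map_homog p i j :
  homogz (res_degree (p := p.+1) i - res_degree (p := p) j) (res_map p i j).
Proof.
case: HE => _ [dgen ddiff] _ _ _; case: p i j => [|p] i j; last exact: ddiff.
by rewrite /= subr0 (ord1 j).
Qed.

Lemma res_map_exact p (u : 'rV[R]_(res_rank p.+1)) :
  u *m res_map p = 0 <-> exists v, u = v *m res_map p.+1.
Proof.
by case: HE => _ _ [_ ex1] ex _; case: p u => [|p] u; [exact: ex1 | exact: ex].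
Qed.

Lemma res_image p : J p <-> exists u : 'rV_(res_rank 1), p = (u *m res_map 0) 0 0.
Proof. by case: HE => _ _ [HJ _] _ _; exact: HJ. Qed.

Lemma socle_last_shift theta d f : (0 < n)%N ->
  (forall l, homogz 1 (theta l)) -> weakly_regular theta n.+1 ->
  (forall u : R, u@_0%MM = 0 -> span theta n.+1 u) -> regular_mod J (theta 0%N) ->
  homogz d f -> ~ (exists p b, J p /\ f = p + theta 0%N * b) ->
  (forall l, exists p b, J p /\ theta l * f = p + theta 0%N * b) ->
  exists i : 'I_(size (res_shifts E n)), (res_shifts E n)`_i = d + n%:Z.
Proof.
move=> n_gt0 dtheta reg gen reg0 df f_notin f_soc.
have spanE (x : 'rV[R]_1) w : rspan theta 1 (x - w *m res_map 0) <->
    exists b, x 0 0 = (w *m res_map 0) 0 0 + theta 0%N * b.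
  split=> [/(_ 0)|[b xE] j].
    move=> /span_step [b /span0P]; rewrite !mxE => xE; exists b.
    by apply/eqP; rewrite -subr_eq0 opprD addrA; apply/eqP.
  by apply/span_step; exists b; apply/span0P;
    rewrite !mxE (ord1 j) xE !mxE addrC addKr subrr.
have [|||i iE] := @socle_shift k N res_rank res_degree res_map
  res_map_homog res_map_exact theta n dtheta reg _ gen d (const_mx f).
- move=> y u yu; have /reg0 /res_image [w yE] : J (theta 0%N * y 0 0).
    by apply/res_image; exists u; rewrite -yu mxE.
  by exists w; apply/matrixP => i j; rewrite (ord1 i) (ord1 j).
- by move=> i; rewrite mxE /= subr0.
- split=> [[w /spanE [b fE]]|l _].
    apply: f_notin; exists ((w *m res_map 0) 0 0), b; rewrite mxE in fE.
    by split=> //; apply/res_image; exists w.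
  have [p [b [/res_image [w ->] fE]]] := f_soc l.
  by exists w; apply/spanE; exists b; rewrite !mxE fE !mxE.
(* For [n > 0] the rank at index [n] is the number of shifts of [F_n]. *)
- by case: n n_gt0 i iE => // n' _ i iE; exists i.
Qed.

End Resolutions.

(** * Both shifts from one section of [O_C(m)] *)

Section MainTheorem.

Variables (k : closedFieldType) (n : nat) (I : {mpoly k[n.+2]} -> Prop).
Hypotheses (n_gt0 : (0 < n)%N) (homogI : homogeneous_ideal I) (satI : saturated I).
Hypothesis HBuch : arithmetically_Buchsbaum I.
Variables (m : int) (s : 'I_n.+2 -> {fraction {mpoly k[n.+2]}}).
Hypotheses (Hs : global_section I m s) (s_nonlift : ~ lifts I m s).

Lemma section_shifts a B (E : res_data k n.+1) : a != 0 ->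
  regular_mod I (lform a) -> hyperplane_coords a B ->
  minimal_free_resolution n (section_ideal I B) E ->
  (exists j : 'I_(size (res_shifts E 1)), (res_shifts E 1)`_j = m + 1) /\
  (exists i : 'I_(size (res_shifts E n)), (res_shifts E n)`_i = m + 1 + n%:Z).
Proof.
move=> a0 Lreg [Bfree Ba0] HE; have HI := homogI.1.
have i01 : (ord0 : 'I_n.+2) != ord_max by [].
have BC := mulmxVp Bfree; set C := pinvmx B in BC.
have [rho [rhoE rho_lform]] := exists_substitution B^T.
have [sigma [_ sigma_lform]] := exists_substitution C^T.
have {}rhoE f : restrict_poly B f = rho f.
  rewrite rhoE /restrict_poly; congr (_ \mPo _); apply: eq_mktuple => i.
  by apply: eq_bigr => j _; rewrite !mxE.
have sigK := sigmaK BC rho_lform sigma_lform.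
have rhoL := rho_hyperplane Ba0 rho_lform.
have rho_mod := sigma_rho_mod a0 Bfree Ba0 BC rho_lform sigma_lform.
have sec := section_idealE a0 Bfree Ba0 BC rhoE rho_lform sigma_lform HI.
have res := restricted_idealE a0 Bfree Ba0 BC rhoE rho_lform sigma_lform I.
have HIX := IX_ideal BC rhoE rho_lform sigma_lform HI.
have HJ := restricted_ideal_ideal BC rhoE rho_lform sigma_lform HI.
have rho_homog d f : homogz d f -> homogz d (rho f).
  apply: homogz_substitution => i; rewrite -lform_delta rho_lform.
  exact: homogz_lform.
have sigma_homog d f : homogz d f -> homogz d (sigma f).
  apply: homogz_substitution => i; rewrite -lform_delta sigma_lform.
  exact: homogz_lform.
split.
  have [g Hg] := Buchsbaum_lifts HI a i01 HBuch Hs.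
  have [Sg nILg] := lform_lift_section_cone HI homogI Lreg Hs s_nonlift Hg.
  apply: (generator_degree HE HJ _ (rho_homog _ _ Hg.1)).
  - move=> e p i dp; rewrite -[p]sigK => /sec Sp.
    rewrite -['X_i]sigK -rmorphM; apply/res; rewrite -lform_delta sigma_lform.
    apply: (section_cone_socle HI homogI HBuch i01 satI Lreg _ _ Sp).
    exact: sigma_homog dp.
  - exact/sec.
  - by move/res.
have [|z0 z0_neq0 z0reg] := exists_regular_lform HIX _ (ltn0Sn n).
  exact: saturated_saturation.
(* [z0] lives in the coordinates of the hyperplane; multiplying [s] requires a linear form on
   [P^(n+1)], and the lift [z] inherits regularity through [sec]. *)
pose z := z0 *m C^T.
have sigz : sigma (lform z0) = lform z by exact: sigma_lform.
have zreg : regular_mod (saturation (section_cone I a)) (lform z).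
  by move=> f /sec; rewrite rmorphM /= -sigz sigK => /z0reg /sec.
have [g Hg] := Buchsbaum_lifts HI z i01 HBuch Hs.
have [theta [theta0 theta_lform theta_reg theta_gen]] := linear_parameters z0_neq0.
apply: (@socle_last_shift _ _ _ _ _ HE theta _ (rho g)) => //.
- by move=> l; have [w ->] := theta_lform l; exact: homogz_lform.
- by rewrite theta0.
- exact: rho_homog Hg.1.
- rewrite theta0 => -[p [b [Ip gE]]].
  have [h gh] := rho_mod g.
  apply: (lform_lift_notin HI homogI HBuch i01 Lreg Hs s_nonlift zreg Hg).
  exists (sigma p + lform a * h), (sigma b); split.
    by apply/sec; rewrite rmorphD rmorphM /= rhoL mul0r addr0 sigK.
  by rewrite -gh gE rmorphD rmorphM /= -sigz; ring.
- move=> l; have [w ->] := theta_lform l; rewrite theta0.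
  have [h Hh] := lform_lift_socle HI HBuch i01 satI a Hs (w *m C^T) Hg.
  exists (rho (lform (w *m C^T) * g - lform z * h)), (rho h); split.
    by apply/sub_saturation => //; apply/res.
  by rewrite rmorphB !rmorphM /= -sigz -sigma_lform !sigK subrK.
Qed.

End MainTheorem.

Theorem proposition4p4 (k : closedFieldType) (n : nat) (n_gt0 : (0 < n)%N)
    (I : {mpoly k[n.+2]} -> Prop)
    (hC : curve I)
    (hBuchsbaum : arithmetically_Buchsbaum I)
    (hnACM : ~ arithmetically_CM I) :
  for_general_hyperplane (fun a : 'rV[k]_n.+2 =>
    forall (B : 'M[k]_(n.+1, n.+2)) (E : res_data k n.+1),
      hyperplane_coords a B ->
      minimal_free_resolution n (section_ideal I B) E ->
      sorted >=%R (res_shifts E n) ->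
      sorted >=%R (res_shifts E 1) ->
      exists i j, lifting_matrix n E i j = n%:Z).
Proof.
case: hC => homogI satI _ _ _.
(* Splitting cocycles takes three charts; the indices [0], [1] and [n + 1] are distinct because
   [n > 0]. *)
have i12 : (inord 1 : 'I_n.+2) != ord_max.
  by rewrite -(inj_eq val_inj) /= inordK // eqSS eq_sym -lt0n.
have i01 : (ord0 : 'I_n.+2) != inord 1.
  by rewrite -(inj_eq val_inj) /= inordK.
have i02 : (ord0 : 'I_n.+2) != ord_max by [].
have [m [s [Hs s_nonlift]]] := exists_nonliftable i01 i02 i12 hBuchsbaum hnACM.
have [F [F_neq0 F_homog HF]] := general_regular_hyperplane homogI.1 satI.
exists F; split=> // a a_neq0 Fa B E HB HE _ _.
have [[j jE] [i iE]] := section_shifts n_gt0 homogI satI hBuchsbaum Hs s_nonlift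
  a_neq0 (HF a a_neq0 Fa) HB HE.
by exists i, j; rewrite mxE iE jE addrAC subrr add0r.
Qed.
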